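(* Let $\mathcal M$ be a finitely branching countable MDP, let $\{A_i\}_{i\in\mathbb N}$ be a sequence of sets of transitions of $\mathcal M$ that is monotone decreasing with respect to set inclusion, and consider the objective $\varphi=\bigcap_{i\in\mathbb N}\mathsf F\mathsf G A_i$. There exists a single memoryless deterministic (MD) strategy that is optimal for $\varphi$ from every state that has an optimal strategy for $\varphi$.
   Context: An MDP $\mathcal M$ consists of a countable set $S$ of states partitioned into controlled states $S_C$ and random states $S_R$; a transition relation $\longrightarrow\subseteq S\times S$ such that every state has at least one successor; and a function $P$ assigning to each random state $s$ a probability distribution on the set $\mathrm{Succ}(s)$ of successors of $s$. It is finitely branching if $\mathrm{Succ}(s)$ is finite for every state $s$ (controlled or random). A run is an infinite sequence $s_0e_0s_1e_1\cdots$ with $e_i=(s_i,s_{i+1})\in\longrightarrow$; a history is a finite prefix of a run ending in a controlled state. A (general) strategy $\sigma$ maps each history ending in $s$ to a probability distribution on $\mathrm{Succ}(s)$. It is deterministic if all these distributions are Dirac, and memoryless if they depend only on the current state. A strategy and a start state $s$ induce a probability measure $\mathcal P_{\mathcal M,s,\sigma}$ on the Borel $\sigma$-algebra of runs from $s$. For an event $\varphi$, $\mathrm{val}(s)=\sup_\sigma\mathcal P_{\mathcal M,s,\sigma}(\varphi)$ over all strategies; $\sigma$ is optimal for $\varphi$ from $s$ if $\mathcal P_{\mathcal M,s,\sigma}(\varphi)=\mathrm{val}(s)$. $\mathsf F\mathsf G A$ is the set of runs all but finitely many of whose transitions are in $A$. *)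

(* Defs.v *)
From HB Require Import structures.
From mathcomp Require Import all_boot all_order all_algebra.
From mathcomp Require Import mathcomp_extra boolp classical_sets functions.
From mathcomp Require Import cardinality fsbigop reals interval_inference.
From mathcomp Require Import constructive_ereal ereal topology normedtype.
From mathcomp Require Import sequences esum measure.

Set Implicit Arguments.
Unset Strict Implicit.
Unset Printing Implicit Defensive.

Import Order.TTheory GRing.Theory Num.Theory.

Local Open Scope classical_set_scope.
Local Open Scope ring_scope.

Definition is_distr (R : realType) (S : countType) (A : set S) (p : S -> R) :=
  [/\ forall t, 0 <= p t, forall t, ~ A t -> p t = 0
    & (\esum_(t in [set: S]) (p t)%:E = 1)%E].

(* The states that are not controlled are the random ones; [prob s] is junk when
   [s] is controlled. *)
Record mdp (R : realType) (S : countType) := Mdp {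
  controlled : pred S ;
  edge : rel S ;
  prob : S -> S -> R ;
  edge_serial : forall s, exists t, edge s t ;
  prob_distr : forall s, ~~ controlled s -> is_distr [set t | edge s t] (prob s)
}.

Section Mdp.
Context (R : realType) (S : countType) (M : mdp R S).
Implicit Types (s t x : S) (p q r : seq S).

Definition succs s : set S := [set t | edge M s t].

Definition transitions : set (S * S) := [set e | edge M e.1 e.2].

Definition finitely_branching := forall s, finite_set (succs s).

(* The finite sequence of states s :: p is a history: it follows transitions and
   ends in a controlled state. *)
Definition history s p := path (edge M) s p && controlled M (last s p).

(* [move s p] is the distribution chosen after the history s :: p; it is junk
   when s :: p is not a history. *)
Record strategy := Strategy {
  move :> S -> seq S -> S -> R ;
  move_distr : forall s p, history s p -> is_distr (succs (last s p)) (move s p)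
}.

Definition deterministic (sigma : strategy) :=
  forall s p, history s p -> exists t, sigma s p =1 fun u => (u == t)%:R.

Definition memoryless (sigma : strategy) :=
  forall s p s' p', history s p -> history s' p' ->
    last s p = last s' p' -> sigma s p =1 sigma s' p'.

(* Runs from s; the edges are determined by the states. *)
Record run s := Run {
  state :> nat -> S ;
  state0 : state 0%N = s ;
  state_edge : forall n, edge M (state n) (state n.+1)
}.

HB.instance Definition _ s := gen_eqMixin (run s).
HB.instance Definition _ s := gen_choiceMixin (run s).

Definition default_succ s := xchoose (edge_serial M s).

Definition default_run s : run s :=
  @Run s (fun n => iter n default_succ s) erefl
    (fun n => xchooseP (edge_serial M (iter n default_succ s))).

HB.instance Definition _ s := isPointed.Build (run s) (default_run s).

(* The runs from s that start with s :: p. *)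
Definition cylinder s p : set (run s) :=
  [set w | mkseq (fun i => w i.+1) (size p) = p].

Definition cylinders s : set (set (run s)) := range (@cylinder s).
Arguments cylinders s : clear implicits.

(* The cylinders are a countable basis of the product topology on runs, so that
   they generate its Borel sigma-algebra. *)
Notation runs s := (g_sigma_algebraType (cylinders s)).

Definition step (sigma : strategy) s p : S -> R :=
  if controlled M (last s p) then sigma s p else prob M (last s p).

(* The probability that the run from s starts with s :: p. *)
Definition cylinder_weight (sigma : strategy) s p : R :=
  \prod_(i < size p) step sigma s (take i p) (nth s p i).

(* The outer measure of X: the infimum of the total weights of its covers by
   cylinders. On the Borel sets this is the probability measure that gives each
   cylinder its weight (see the instances and run_prob_cylinder below). *)
Definition run_prob (sigma : strategy) s (X : set (runs s)) : \bar R :=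
  ereal_inf [set (\esum_(p in F) (cylinder_weight sigma s p)%:E)%E
            | F in [set F | X `<=` \bigcup_(p in F) @cylinder s p]].

Section run_prob_probability.
Variables (sigma : strategy) (s0 : S).

Local Notation w := (cylinder_weight sigma s0).
Local Notation mu := (@run_prob sigma s0).
Local Notation cyl := (@cylinder s0).

Lemma step_distr p : path (edge M) s0 p ->
  is_distr (succs (last s0 p)) (step sigma s0 p).
Proof.
move=> pp; rewrite /step; case: ifPn => [cp|]; last exact: prob_distr.
by apply: move_distr; rewrite /history pp.
Qed.

Lemma cylinder_weight_nil : w [::] = 1.
Proof. by rewrite /cylinder_weight big_ord0. Qed.

Lemma cylinder_weight_rcons p x : w (rcons p x) = w p * step sigma s0 p x.
Proof.
rewrite /cylinder_weight size_rcons big_ord_recr/= -cats1 take_size_cat//.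
rewrite nth_cat ltnn subnn/=; congr (_ * _); apply: eq_bigr => i _.
by rewrite takel_cat ?nth_cat ?ltn_ord// ltnW.
Qed.

Lemma cylinder_weight_path p : w p != 0 -> path (edge M) s0 p.
Proof.
elim/last_ind: p => // p x IH; rewrite cylinder_weight_rcons mulf_eq0 negb_or.
move=> /andP[/IH pp st0]; rewrite rcons_path pp/=.
have [_ supp _] := step_distr pp.
by apply/negPn/negP => npx; move: st0; rewrite supp ?eqxx//; exact/negP.
Qed.

Lemma cylinder_weight_ge0 p : 0 <= w p.
Proof.
elim/last_ind: p => [|p x IH]; first by rewrite cylinder_weight_nil.
rewrite cylinder_weight_rcons.
have [->|/cylinder_weight_path/step_distr[st0 _ _]] := eqVneq (w p) 0.
  by rewrite mul0r.
exact: mulr_ge0.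
Qed.

Local Open Scope ereal_scope.

Let wE_ge0 p : 0 <= (w p)%:E.
Proof. by rewrite lee_fin cylinder_weight_ge0. Qed.
Local Hint Resolve wE_ge0 : core.

Let esumZl (c : R) (f : S -> R) : (0 < c)%R -> (forall x, (0 <= f x)%R) ->
  \esum_(x in [set: S]) (c * f x)%:E = c%:E * \esum_(x in [set: S]) (f x)%:E.
Proof.
have le_esumZl (a : R) (g : S -> R) : (0 < a)%R -> (forall x, (0 <= g x)%R) ->
    \esum_(x in [set: S]) (a * g x)%:E <= a%:E * \esum_(x in [set: S]) (g x)%:E.
  move=> a0 g0; apply: ge_ereal_sup => _ [F FT <-].
  under eq_fsbigr do rewrite EFinM.
  rewrite -ge0_mule_fsumr => [|x]; last by rewrite lee_fin.
  by rewrite lee_pmul2l// esum_ge//; exists F.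
move=> c0 f0; apply/eqP; rewrite eq_le le_esumZl//=.
rewrite -(@lee_pmul2l _ c^-1%:E)// ?lte_fin ?invr_gt0// muleA -EFinM.
rewrite mulVf ?gt_eqF// mul1e (eq_esum (b := fun x => (c^-1 * (c * f x))%:E)).
  by apply: le_esumZl => [|x]; rewrite ?invr_gt0// mulr_ge0// ltW.
by move=> x _; rewrite mulKf// gt_eqF.
Qed.

Lemma esum_cylinder_weight_rcons p :
  \esum_(x in [set: S]) (w (rcons p x))%:E = (w p)%:E.
Proof.
rewrite (eq_esum (b := fun x => (w p * step sigma s0 p x)%:E)); last first.
  by move=> x _; rewrite cylinder_weight_rcons.
have [wp0|wp0] := eqVneq (w p) 0%R.
  by rewrite esum1 wp0// => x _; rewrite mul0r.
have [st0 _ st1] := step_distr (cylinder_weight_path wp0).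
by rewrite esumZl ?st1 ?mule1// lt0r wp0 cylinder_weight_ge0.
Qed.

Lemma cylinder_weight_cat p q : (w (p ++ q) <= w p)%R.
Proof.
elim/last_ind: q => [|q x IH]; first by rewrite cats0.
apply: le_trans IH; rewrite -rcons_cat -lee_fin.
rewrite -(esum_cylinder_weight_rcons (p ++ q)).
apply: esum_ge; exists [set x]; first by split => //; exact: finite_set1.
by rewrite fsbig_set1.
Qed.

Let esum_subset (T : choiceType) (A B : set T) (a : T -> \bar R) :
  (forall i, 0 <= a i) -> A `<=` B ->
  \esum_(i in A) a i <= \esum_(i in B) a i.
Proof.
move=> a0 AB; apply: ge_ereal_sup => _ [F [finF FA] <-].
by apply: esum_ge; exists F => //; split=> //; exact: subset_trans AB.
Qed.

Let mu_ge0 X : 0 <= mu X.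
Proof. by apply: le_ereal_inf_tmp => _ [F _ <-]; exact: esum_ge0. Qed.

Let mu0 : mu set0 = 0.
Proof.
apply/eqP; rewrite eq_le mu_ge0 andbT; apply: ereal_inf_lbound.
by exists set0; rewrite ?esum_set0.
Qed.

Let le_mu : {homo mu : A B / A `<=` B >-> A <= B}.
Proof.
move=> A B AB; apply: ereal_inf_le_tmp => _ [F BF <-].
by exists F => //; exact: subset_trans BF.
Qed.

Let mu_lb X F : X `<=` \bigcup_(p in F) cyl p ->
  mu X <= \esum_(p in F) (w p)%:E.
Proof. by move=> XF; apply: ereal_inf_lbound; exists F. Qed.

Let mu_sigma_subadditive : sigma_subadditive mu.
Proof.
move=> A; have [[i ioo]|] := pselect (exists i, mu (A i) = +oo).
  rewrite (eseries_pinfty _ _ ioo) ?leey// => n _.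
  by rewrite -ltNye (lt_le_trans _ (mu_ge0 _)).
rewrite -forallNE => Aoo; apply/lee_addgt0Pr => e e0.
apply: le_trans (epsilon_trick _ (fun n => mu_ge0 (A n)) (ltW e0)).
pose P n (F : set (seq S)) := A n `<=` \bigcup_(p in F) cyl p /\
  \esum_(p in F) (w p)%:E <= mu (A n) + (e / (2 ^ n.+1)%:R)%:E.
have [F FP] : {F : nat -> set (seq S) & forall n, P n (F n)}.
  apply: choice => n; rewrite /P.
  have en0 : (0 < e / (2 ^ n.+1)%:R)%R by rewrite divr_gt0// ltr0n expn_gt0.
  have fA : mu (A n) \is a fin_num.
    by rewrite ge0_fin_numE// ltey; exact/eqP/Aoo.
  have [_ [F AF <-] Fe] := lb_ereal_inf_adherent en0 fA.
  by exists F; split=> //; exact: ltW.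
apply: (@le_trans _ _ (\esum_(p in \bigcup_n F n) (w p)%:E)).
  apply: mu_lb => x [n _ /(FP n).1[p Fp xp]].
  by exists p => //; exists n.
apply: (@le_trans _ _ (\sum_(n <oo) \esum_(p in F n) (w p)%:E)); last first.
  by apply: lee_nneseries => [n _ _|n _]; [exact: esum_ge0|exact: (FP n).2].
rewrite nneseries_esumT; last by move=> n; exact: esum_ge0.
rewrite (esum_esum (I := setT) (J := F) (a := fun _ p => (w p)%:E))//.
have [h hF] : {h : seq S -> nat &
    forall p, (\bigcup_n F n) p -> F (h p) p}.
  apply: (choice (P := fun p n => (\bigcup_n F n) p -> F n p)) => p.
  have [[n _ Fn]|nF] := pselect ((\bigcup_n F n) p); first by exists n.
  by exists 0%N.
rewrite -(esum_image _ (fun p => (h p, p)) (fun k => (w k.2)%:E)); last first.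
  by move=> p q _ _ [].
by apply: esum_subset => // _ [p Fp <-]; split => //=; exact: hF.
Qed.

HB.instance Definition _ := isOuterMeasure.Build R (run s0) mu
  mu0 mu_ge0 le_mu mu_sigma_subadditive.

Let mu_cylinder q : mu (cyl q) = (w q)%:E.
Proof.
apply/eqP; rewrite eq_le; apply/andP; split.
  rewrite -(esum_set1 (t := q) (a := fun p => (w p)%:E))//.
  by apply: mu_lb => x; rewrite bigcup_set1.
apply: le_ereal_inf_tmp => _ [F qF <-]; rewrite leNgt; apply/negP => Fq.
pose c g := \esum_(p in F `&` [set p | prefix g p]) (w p)%:E.
have le_wF p : F p -> (w p)%:E <= \esum_(p in F) (w p)%:E.
  move=> Fp; apply: esum_ge; exists [set p]; last by rewrite fsbig_set1.
  by split; [exact: finite_set1|move=> _ ->].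
have next g : c g < (w g)%:E -> exists x, c (rcons g x) < (w (rcons g x))%:E.
  move=> cg; apply/not_existsP => ncg.
  move: cg; apply/negP; rewrite -leNgt -esum_cylinder_weight_rcons.
  apply: (@le_trans _ _ (\esum_(x in [set: S]) c (rcons g x))).
    by apply: le_esum => x _; rewrite leNgt; exact/negP.
  rewrite /c (esum_esum (a := fun _ p => (w p)%:E))//.
  rewrite -(esum_image _ snd (fun p => (w p)%:E)); last first.
    move=> [x p] [y r]; rewrite !inE/= => -[_ [_ /prefixP[u ->]]].
    move=> [_ [_ /prefixP[v ->]]] /eqP.
    by rewrite !cat_rcons eqseq_cat// eqxx/= => /eqP[-> ->].
  apply: esum_subset => // _ [[x p] [_ [/= Fp /prefixP[u pE]]] <-].
  by split => //=; rewrite pE cat_rcons prefix_prefix.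
pose f n := iter n (fun g =>
  if pselect (exists x, c (rcons g x) < (w (rcons g x))%:E) is left e
  then rcons g (sval (cid e)) else g) q.
have fS n : c (f n) < (w (f n))%:E /\ exists x, f n.+1 = rcons (f n) x.
  elim: n => [|n [/next fn [x fn1]]].
    have cq : c q < (w q)%:E.
      by apply: le_lt_trans Fq; apply: esum_subset => // p [Fp _].
    split=> //=; case: pselect => [e|/(_ (next _ cq))//].
    by exists (sval (cid e)).
  have cfn1 : c (f n.+1) < (w (f n.+1))%:E.
    by rewrite /f/= -/(f n); case: pselect => // e; case: cid.
  split=> //; rewrite [f n.+2]/=.
  case: pselect => [e|/(_ (next _ cfn1))//].
  by exists (sval (cid e)).
have fsize n : size (f n) = (size q + n)%N.
  elim: n => [|n IH]; first by rewrite addn0.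
  by have [_ [x ->]] := fS n; rewrite size_rcons IH addnS.
have fpath n : path (edge M) s0 (f n).
  apply: cylinder_weight_path; rewrite gt_eqF// -lte_fin.
  by apply: le_lt_trans (fS n).1; exact: esum_ge0.
have fprefix m n : (m <= n)%N -> prefix (f m) (f n).
  move=> /subnKC <-; elim: (n - m)%N => [|k IH].
    by rewrite addn0 prefix_refl.
  rewrite addnS; have [_ [x ->]] := fS (m + k)%N.
  by apply: prefix_trans IH _; rewrite -cats1 prefix_prefix.
have fnth m n i : (i < size (f m))%N -> (m <= n)%N ->
    nth s0 (f n) i = nth s0 (f m) i.
  by move=> im /fprefix/prefixP[r ->]; rewrite nth_cat im.
pose st i := nth s0 (s0 :: f i) i.
have st_edge i : edge M (st i) (st i.+1).
  have ifi : (i < size (f i.+1))%N by rewrite fsize addnS ltnS leq_addl.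
  have /(pathP s0)/(_ i ifi) := fpath i.+1.
  rewrite /st/=; case: i ifi => //= i ifi.
  by rewrite (fnth i.+1 i.+2)// fsize addnS ltnS leq_addl.
pose om : run s0 := @Run s0 st erefl st_edge.
have omf n : mkseq (fun i => om i.+1) (size (f n)) = f n.
  apply: (@eq_from_nth _ s0); rewrite size_mkseq// => i ifn.
  rewrite nth_mkseq//= /st/=.
  have [/fnth->//|/ltnW/fnth->//] := leqP n i.+1.
  by rewrite fsize addnS ltnS leq_addl.
have [p Fp omp] := qF om (omf 0%N).
have [pq|qp] := leqP (size p) (size q).
  move: Fq; apply/negP; rewrite -leNgt; apply: le_trans (le_wF _ Fp).
  have qE : mkseq (fun i => om i.+1) (size q) = q := omf 0%N.
  rewrite lee_fin -omp -{1}qE.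
  rewrite -[X in mkseq _ X](subnKC pq) /mkseq iotaD map_cat.
  exact: cylinder_weight_cat.
have pf : p = f (size p - size q)%N.
  by rewrite -[LHS]omp -[RHS]omf fsize subnKC// ltnW.
have [+ _] := fS (size p - size q)%N; rewrite -pf; apply/negP; rewrite -leNgt.
apply: esum_ge; exists [set p]; last by rewrite fsbig_set1.
by split; [exact: finite_set1|move=> _ ->; split=> //; exact: prefix_refl].
Qed.

Let cylinder_subset p q : prefix p q -> cyl q `<=` cyl p.
Proof.
move=> /prefixP[r ->] y /(congr1 (take (size p))).
rewrite take_size_cat// size_cat /mkseq iotaD map_cat take_size_cat//.
by rewrite size_map size_iota.
Qed.

Let cylinder_prefix p q y : cyl p y -> cyl q y -> (size p <= size q)%N ->
  prefix p q.
Proof.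
move=> <- <-; rewrite !size_mkseq => /subnKC <-.
by rewrite /mkseq iotaD map_cat prefix_prefix.
Qed.

Let cylinder_rcons q y : cyl q y -> cyl (rcons q (y (size q).+1)) y.
Proof. by move=> qy; rewrite /cylinder/= size_rcons mkseqS qy. Qed.

Let cylinder_caratheodory p : mu.-caratheodory (cyl p).
Proof.
elim/last_ind: p => [|q x IH].
  have -> : cyl [::] = setT by apply/seteqP; split.
  by move=> X; rewrite setIT setCT setI0 outer_measure0 adde0.
have sub : cyl (rcons q x) `<=` cyl q.
  exact: cylinder_subset (prefix_rcons _ _).
apply: le_caratheodory_measurable => X.
suff key Y : Y `<=` cyl q ->
    mu (Y `&` cyl (rcons q x)) + mu (Y `&` ~` cyl (rcons q x)) <= mu Y.
  rewrite [leRHS](IH X).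
  apply: (@le_trans _ _ (mu (X `&` cyl q `&` cyl (rcons q x)) +
      mu (X `&` cyl q `&` ~` cyl (rcons q x)) + mu (X `&` ~` cyl q)));
    last first.
    by apply: leeD2r; apply: key => y [].
  rewrite -addeA leeD//.
    by apply: le_mu => y [Xy cy]; split=> //; split=> //; exact: sub.
  apply: le_trans (outer_measureU2 _ _ _); apply: le_mu => y [Xy cy].
  by have [qy|qy] := pselect (cyl q y); [left|right].
move=> Yq; apply: le_ereal_inf_tmp => _ [F YF <-].
have [[r Fr rq]|nF] := pselect (exists2 r, F r & prefix r q).
  apply: (@le_trans _ _ (w q)%:E); last first.
    apply: (@le_trans _ _ (w r)%:E).
      by move/prefixP: rq => [u ->]; rewrite lee_fin cylinder_weight_cat.
    apply: esum_ge; exists [set r]; last by rewrite fsbig_set1.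
    by split; [exact: finite_set1|move=> _ ->].
  rewrite -esum_cylinder_weight_rcons (esumID [set x])// !setTI.
  have inj (A : set S) : set_inj A (rcons q) by move=> y z _ _ /rcons_inj[].
  rewrite -!(esum_image _ (rcons q) (fun p => (w p)%:E))//.
  apply: leeD; apply: mu_lb => y [Yy cy].
    by exists (rcons q x) => //; exists x.
  exists (rcons q (y (size q).+1)); last exact: cylinder_rcons (Yq _ Yy).
  exists (y (size q).+1) => //= yx; apply: cy; rewrite -yx.
  exact: cylinder_rcons (Yq _ Yy).
rewrite (esumID [set p | prefix (rcons q x) p])//.
apply: leeD; apply: mu_lb => y [Yy cy]; have [p Fp py] := YF _ Yy;
    exists p => //.
  split=> //=; apply: (cylinder_prefix cy py); rewrite size_rcons ltnNge.
  apply/negP => pq; apply: nF; exists p => //.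
  exact: cylinder_prefix py (Yq _ Yy) pq.
by split=> // qp; apply: cy; exact: cylinder_subset qp _ py.
Qed.

Let measurable_caratheodory (X : set (runs s0)) :
  measurable X -> mu.-caratheodory X.
Proof.
move=> mX; apply: (mX mu.-caratheodory); split.
  split; [exact: caratheodory_measurable_set0| |].
    by move=> A mA; rewrite setTD; exact: caratheodory_measurable_setC.
  by move=> A mA; exact: caratheodory_measurable_bigcup.
by move=> _ [p _ <-]; exact: cylinder_caratheodory.
Qed.

Let mu_semi_sigma_additive : semi_sigma_additive mu.
Proof.
move=> A mA tA mUA.
exact: (caratheodory_measure_sigma_additive (mu := mu)
  (fun n => measurable_caratheodory (mA n)) tA (measurable_caratheodory mUA)).
Qed.

HB.instance Definition _ := isMeasure.Build _ (runs s0) R mu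
  mu0 mu_ge0 mu_semi_sigma_additive.

Let mu_setT : mu setT = 1.
Proof.
have -> : setT = cyl [::] by apply/seteqP; split.
by rewrite mu_cylinder cylinder_weight_nil.
Qed.

HB.instance Definition _ :=
  Measure_isProbability.Build _ (runs s0) R mu mu_setT.

Lemma run_prob_cylinder p : mu (cyl p) = (w p)%:E.
Proof. exact: mu_cylinder. Qed.

Lemma measurable_cylinder p : measurable (cyl p : set (runs s0)).
Proof. by apply: sub_sigma_algebra; exists p. Qed.

End run_prob_probability.

Definition FG s (A : set (S * S)) : set (runs s) :=
  [set w | \forall n \near \oo, A (w n, w n.+1)].

Lemma measurable_FG s A : measurable (FG (s := s) A).
Proof.
have -> : FG (s := s) A = \bigcup_n \bigcap_(m in [set m | (n <= m)%N])
    [set w : runs s | A (w m, w m.+1)].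
  by apply/seteqP; split=> [w [n _ nA]|w [n _ nA]]; exists n.
apply: bigcupT_measurable => n; apply: bigcap_measurable => [|m _].
  by exists n => /=.
have -> : [set w : runs s | A (w m, w m.+1)] =
    \bigcup_(p in [set p | size p = m.+1 /\
       A (nth s (s :: p) m, nth s p m)]) @cylinder s p.
  have nthE (w : run s) : let p := mkseq (fun i => w i.+1) m.+1 in
      nth s (s :: p) m = w m /\ nth s p m = w m.+1.
    split; last by rewrite nth_mkseq.
    by case: m => [|m] /=; rewrite ?state0// nth_mkseq.
  apply/seteqP; split=> [w wA|w [p [ps pA] pw]].
    have [e1 e2] := nthE w.
    exists (mkseq (fun i => w i.+1) m.+1); last first.
      exact: (congr1 (mkseq _) (size_mkseq _ _)).
    by split; [exact: size_mkseq|rewrite e1 e2].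
  have [e1 e2] := nthE w; move: pA; rewrite -pw ps.
  by rewrite e1 e2.
rewrite bigcup_mkcond; apply: countable_bigcupT_measurable => // p.
by case: ifP => _; [exact: measurable_cylinder|exact: measurable0].
Qed.

Definition val s (phi : set (runs s)) : \bar R :=
  ereal_sup [set run_prob sigma phi | sigma in [set: strategy]].

Definition optimal (sigma : strategy) s (phi : set (runs s)) :=
  run_prob sigma phi = val phi.

End Mdp.

Notation runs M s := (g_sigma_algebraType (@cylinders _ _ M s)).

Arguments FG {R S} M s A.

(* Main.v *)
Require Import Defs.
From mathcomp Require Import all_boot all_order all_algebra.
From mathcomp Require Import boolp classical_sets reals.
From mathcomp Require Import mathcomp_extra functions cardinality fsbigop.
From mathcomp Require Import constructive_ereal ereal topology normedtype.
From mathcomp Require Import sequences esum measure lra.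

(* Write v(s) for the value of the objective and O for the set of states that
   have an optimal strategy. Optimal strategies only use edges that stay in O
   and preserve v, so v is a martingale under any strategy that conforms to
   these edges.

   Zero-one argument: if, in a restriction C of these edges, some constant
   fraction c > 0 of v can be achieved from every state of O, then all of v can
   be approximated in C. Indeed, follow a strategy until the run enters a cover
   by cylinders of the complement of the objective, of almost the same measure,
   then restart; this regains a fraction c of the missing value.

   Plastering: given s in O, choose times n_i such that a nearly optimal
   strategy stays in every A_i from time n_i on with nearly the same
   probability. Let an edge whose first missed set is A_i survive with
   probability 1 - e / 2^(n_i + 1). Maximising the survival probability V is a
   safety problem, so finite branching provides a memoryless deterministic
   optimal strategy g; a positive survival weight along a run implies the
   objective, and V(s) is close to v(s). Fix g on Q = {V >= v / 3}. From s, V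
   does not often fall below v / 3, so every strategy that agrees with g on Q
   achieves v(s) / 2. Playing freely until Q is entered and g from then on still
   achieves v / 4 everywhere in O, so the zero-one argument applies again.

   Do this for all states in turn. By finite branching some memoryless
   deterministic strategy respects all the restrictions; it achieves v / 2 on
   O, hence v by the zero-one argument. *)

Set Implicit Arguments.
Unset Strict Implicit.
Unset Printing Implicit Defensive.

Import Order.TTheory GRing.Theory Num.Theory numFieldNormedType.Exports.

Local Open Scope classical_set_scope.
Local Open Scope ring_scope.

(** * Sums of nonnegative families *)

Lemma esum_subset (R : realType) (T : choiceType) (A B : set T)
    (a : T -> \bar R) : (forall i, 0 <= a i)%E -> A `<=` B ->
  (\esum_(i in A) a i <= \esum_(i in B) a i)%E.
Proof.
move=> a0 AB; apply: ge_ereal_sup => _ [F [finF FA] <-].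
by apply: esum_ge; exists F => //; split=> //; exact: subset_trans AB.
Qed.

Lemma esumMl (R : realType) (T : choiceType) (A : set T) (c : R) (a : T -> R) :
  0 <= c -> (forall i, 0 <= a i) ->
  (\esum_(i in A) (c * a i)%:E <= c%:E * \esum_(i in A) (a i)%:E)%E.
Proof.
move=> c0 a0; apply: ge_ereal_sup => _ [F [finF FA] <-].
under eq_fsbigr do rewrite EFinM.
rewrite -ge0_mule_fsumr => [|x]; last by rewrite lee_fin.
rewrite lee_pmul// ?lee_fin// ?esum_ge//; last by exists F.
by apply: fsume_ge0 => i _; rewrite lee_fin.
Qed.

(** * Probabilities of sets of state sequences *)

Section Runs.
Context (R : realType) (S : countType) (M : mdp R S).
Implicit Types (s t u : S) (p q r : seq S) (f : nat -> S).
Implicit Types X Y : set (nat -> S).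
Implicit Types sigma tau kappa : strategy M.

Local Notation w := cylinder_weight.

Definition event X s : set (runs M s) := [set x | X (state x)].

Arguments event X s : clear implicits.

Definition pre f n := mkseq (fun i => f i.+1) n.

Definition starts p : set (nat -> S) := [set f | pre f (size p) = p].

Definition mble X := forall s, measurable (event X s).

Definition Pr sigma s X : R := fine (run_prob sigma (event X s)).

Lemma size_pre f n : size (pre f n) = n.
Proof. exact: size_mkseq. Qed.

Lemma preS f n : pre f n.+1 = rcons (pre f n) (f n.+1).
Proof. exact: mkseqS. Qed.

Lemma starts_pre f n : starts (pre f n) f.
Proof. by rewrite /starts/= size_pre. Qed.

Lemma last_pre s f n : f 0%N = s -> last s (pre f n) = f n.
Proof. by case: n => [|n] // f0; rewrite preS last_rcons. Qed.

Lemma pre_take f m n : (m <= n)%N -> take m (pre f n) = pre f m.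
Proof. by move=> mn; rewrite -map_take take_iota (minn_idPl mn). Qed.

Lemma pre_cat f m n : pre f (m + n) = pre f m ++ pre (fun i => f (m + i)%N) n.
Proof.
rewrite /pre /mkseq iotaD map_cat add0n -[X in iota X n]addn0 iotaDl -map_comp.
by congr cat; apply: eq_map => i /=; rewrite addnS.
Qed.

Lemma starts_take p f k : starts p f -> (k <= size p)%N -> pre f k = take k p.
Proof. by move=> <-; rewrite size_pre => /pre_take->. Qed.

Lemma starts_rcons p u f :
  starts (rcons p u) f <-> starts p f /\ f (size p).+1 = u.
Proof.
rewrite /starts/= size_rcons preS; split=> [/rcons_inj[]//|[-> ->]//].
Qed.

Lemma mble_starts p : mble (starts p).
Proof. by move=> s; exact: measurable_cylinder. Qed.

Lemma mble_setT : mble setT.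
Proof. by move=> s; exact: measurableT. Qed.

Lemma mble_setC X : mble X -> mble (~` X).
Proof. by move=> mX s; exact: measurableC. Qed.

Lemma mble_setI X Y : mble X -> mble Y -> mble (X `&` Y).
Proof. by move=> mX mY s; exact: measurableI. Qed.

Lemma mble_bigcap (X : nat -> set (nat -> S)) :
  (forall n, mble (X n)) -> mble (\bigcap_n X n).
Proof.
by move=> mX s; apply: bigcapT_measurable => n; exact: mX.
Qed.

(** Since [S] is countable, this event is a countable union of cylinders. *)
Lemma mble_pre (P : S -> set (seq S)) n : mble [set f | P (f 0%N) (pre f n)].
Proof.
move=> s; have -> : event [set f | P (f 0%N) (pre f n)] s =
    \bigcup_(p in [set p | size p = n /\ P s p]) @cylinder _ _ M s p.
  apply/seteqP; split=> [x Px|x [p [pn Pp] px]].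
    exists (pre x n); last exact: starts_pre.
    by split; [exact: size_pre|move: Px; rewrite /event/= state0].
  by rewrite /event/= -pn [pre _ _]px state0.
rewrite bigcup_mkcond; apply: countable_bigcupT_measurable => // p.
by case: ifP => _; [exact: measurable_cylinder|exact: measurable0].
Qed.

Lemma mble_edge (A : set (S * S)) n : mble [set f | A (f n, f n.+1)].
Proof.
rewrite (_ : [set f | _] = [set f |
    A (last (f 0%N) (take n (pre f n.+1)), last (f 0%N) (pre f n.+1))]).
  exact: (mble_pre (fun s => [set p | A (last s (take n p), last s p)])).
apply/funext => f; congr (A (_, _)); last by rewrite last_pre.
by rewrite pre_take// last_pre.
Qed.

Lemma Pr_EFin sigma s X : mble X ->
  (Pr sigma s X)%:E = run_prob sigma (event X s).
Proof.
move=> mX; rewrite fineK//; exact: (@fin_num_measure _ _ _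
  (run_prob sigma (s:=s) : {finite_measure set (runs M s) -> \bar R})).
Qed.

Lemma Pr_ge0 sigma s X : 0 <= Pr sigma s X.
Proof. by rewrite fine_ge0//; exact: measure_ge0. Qed.

Lemma le_Pr sigma s X Y : mble X -> mble Y ->
  (forall x : run M s, X x -> Y x) -> Pr sigma s X <= Pr sigma s Y.
Proof.
move=> mX mY XY; rewrite -lee_fin !Pr_EFin//.
by apply: le_measure; rewrite ?inE.
Qed.

Lemma eq_Pr sigma s X Y :
  (forall x : run M s, X x <-> Y x) -> Pr sigma s X = Pr sigma s Y.
Proof.
move=> XY; rewrite /Pr; congr (fine (run_prob _ _)).
by apply/seteqP; split=> x /XY.
Qed.

Lemma Pr_eq0 sigma s X : (forall x : run M s, ~ X x) -> Pr sigma s X = 0.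
Proof.
move=> X0; rewrite /Pr (_ : event X s = set0); last first.
  by apply/seteqP; split=> x // /X0.
by rewrite measure0.
Qed.

Lemma Pr_starts sigma s p : Pr sigma s (starts p) = w sigma s p.
Proof. by rewrite /Pr [run_prob _ _](run_prob_cylinder sigma s p). Qed.

Lemma Pr_startsI_le sigma s p X : mble X ->
  Pr sigma s (X `&` starts p) <= w sigma s p.
Proof.
move=> mX; rewrite -Pr_starts; apply: le_Pr => [||x []//].
- exact: mble_setI (mble_starts _).
- exact: mble_starts.
Qed.

Lemma Pr_le1 sigma s X : mble X -> Pr sigma s X <= 1.
Proof. by move=> mX; rewrite -lee_fin Pr_EFin// probability_le1. Qed.

Lemma Pr_setC sigma s X : mble X -> Pr sigma s (~` X) = 1 - Pr sigma s X.
Proof.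
move=> mX; apply: EFin_inj; rewrite EFinB !Pr_EFin//; last exact: mble_setC.
exact: (probability_setC (run_prob sigma (s:=s)) (mX s)).
Qed.

Lemma Pr_setID sigma s X Y : mble X -> mble Y ->
  Pr sigma s X = Pr sigma s (X `&` Y) + Pr sigma s (X `&` ~` Y).
Proof.
move=> mX mY; apply: EFin_inj; have mC := mble_setC mY.
rewrite EFinD !Pr_EFin; try exact: mble_setI; try by [].
rewrite addeC; exact: (measureDI (run_prob sigma (s:=s)) (mX s) (mY s)).
Qed.

Lemma Pr_bigcap_ge sigma s (B : nat -> set (nat -> S)) c :
  (forall n, mble (B n)) -> (forall n, B n.+1 `<=` B n) ->
  (forall n, c <= Pr sigma s (B n)) -> c <= Pr sigma s (\bigcap_n B n).
Proof.
move=> mB decB cB; have mI := mble_bigcap mB.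
have cv : (Pr sigma s (B n))%:E @[n --> \oo] -->
    (Pr sigma s (\bigcap_n B n))%:E.
  rewrite Pr_EFin// (_ : (fun n => _) =
    run_prob sigma (s:=s) \o (fun n => event (B n) s)); last first.
    by apply/funext => n /=; rewrite Pr_EFin.
  apply: (@nonincreasing_cvg_mu _ _ _ (run_prob sigma (s:=s))).
  - apply: le_lt_trans (ltry 1).
    exact: (probability_le1 (run_prob sigma (s:=s)) (mB 0%N s)).
  - by move=> n; exact: mB.
  - exact: mI.
  - by apply/nonincreasing_seqP => n; apply/subsetPset => x; exact: decB.
have /fine_cvg/= cvr := cv.
rewrite -(cvg_lim _ cvr)//; apply: limr_ge.
  by apply/cvg_ex; exists (Pr sigma s (\bigcap_n B n)).
by apply: nearW => n /=; exact: cB.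
Qed.

End Runs.

Arguments event {R S} M X s.
Arguments mble {R S} M X.

(** * Residual and switched strategies *)

Section Branching.
Context (R : realType) (S : countType) (M : mdp R S).
Hypothesis fbM : finitely_branching M.
Implicit Types (s t u : S) (p q r : seq S) (f : nat -> S).
Implicit Types X Y : set (nat -> S).
Implicit Types sigma tau kappa : strategy M.

Local Notation w := cylinder_weight.
Local Notation mble := (mble M).

Definition succ_seq t : seq S :=
  undup (sval (cid (iffLR (finite_seqP _) (fbM t)))).

Lemma mem_succ_seq t u : (u \in succ_seq t) = edge M t u.
Proof.
rewrite mem_undup; case: cid => l /= lE.
by apply/idP/idP => [ul|tu]; [have : [set` l] u by []; rewrite -lE|
  have : succs M t u by []; rewrite lE].
Qed.

Lemma succ_seq_uniq t : uniq (succ_seq t).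
Proof. exact: undup_uniq. Qed.

Lemma set_succ_seq t : [set` succ_seq t] = succs M t.
Proof. by apply/seteqP; split=> u /=; rewrite mem_succ_seq. Qed.

Lemma distr_sum t (d : S -> R) : is_distr (succs M t) d ->
  \sum_(u <- succ_seq t) d u = 1.
Proof.
move=> [d0 dN d1]; apply: EFin_inj; rewrite -d1 -sumEFin.
rewrite (fsbig_seq _ _ (succ_seq_uniq t)) set_succ_seq -esum_fset//.
  rewrite esum_mkcond; apply: eq_esum => u _.
  by case: ifPn => // /negP; rewrite inE => /dN ->.
by move=> u _; rewrite lee_fin.
Qed.

Lemma Pr_split sigma s p X : mble X ->
  Pr sigma s (X `&` starts p) =
  \sum_(u <- succ_seq (last s p)) Pr sigma s (X `&` starts (rcons p u)).
Proof.
move=> mX; have mXp q : mble (X `&` starts q).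
  by apply: mble_setI => //; exact: mble_starts.
apply: EFin_inj; rewrite -sumEFin Pr_EFin//.
under eq_bigr do rewrite Pr_EFin//.
rewrite (fsbig_seq _ _ (succ_seq_uniq _)) set_succ_seq.
rewrite -(measure_fin_bigcup (run_prob sigma (s:=s))
  (F := fun u => event M (X `&` starts (rcons p u)) s))//.
- congr (run_prob _ _); apply/seteqP; split=> [x [Xx px]|x [u _ [Xx]]].
    exists (x (size p).+1).
      rewrite /succs/= -[in last s p]px last_pre ?state0//.
      exact: state_edge.
    by split=> //; apply/starts_rcons.
  by move=> /starts_rcons[].
- by move=> u v _ _ [x [[_ /starts_rcons[_ <-]] [_ /starts_rcons[_ <-]]]].
- by move=> u _; exact: mXp.
Qed.

Lemma weight_split sigma s p :
  w sigma s p = \sum_(u <- succ_seq (last s p)) w sigma s (rcons p u).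
Proof.
have := Pr_split sigma s p (@mble_setT _ _ M); rewrite setTI Pr_starts => ->.
by apply: eq_bigr => u _; rewrite setTI Pr_starts.
Qed.

Lemma step_ge0 sigma s p u : path (edge M) s p -> 0 <= step sigma s p u.
Proof. by move=> /(step_distr sigma)[]. Qed.

Lemma sum_step sigma s p : path (edge M) s p ->
  \sum_(u <- succ_seq (last s p)) step sigma s p u = 1.
Proof. by move=> sp; apply: distr_sum; exact: step_distr. Qed.

(** Backward induction from depth [n]. At depth [n] the second alternative is excluded by its size
    condition, so [a] lies below [b] there; this finite comparison serves in place of optional
    stopping. *)
Lemma le_horizon s (a b : seq S -> R) n :
  (forall p, (size p < n)%N ->
     \sum_(u <- succ_seq (last s p)) b (rcons p u) <= b p) ->
  (forall p, (size p <= n)%N -> a p <= b p \/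
     (size p < n)%N /\
     a p <= \sum_(u <- succ_seq (last s p)) a (rcons p u)) ->
  a [::] <= b [::].
Proof.
move=> bS ab.
have key k : forall p, (size p + k)%N = n -> a p <= b p.
  elim: k => [|k IH] p pk; have pn : (size p <= n)%N by rewrite -pk leq_addr.
    by have [//|[]] := ab _ pn; rewrite -pk addn0 ltnn.
  have [//|[{}pn ap]] := ab _ pn; apply: le_trans ap _.
  apply: le_trans (bS _ pn); apply: ler_sum => u _; apply: IH.
  by rewrite size_rcons -pk addSnnS.
by apply: (key n); rewrite add0n.
Qed.

Definition tail X := forall f k, X f <-> X (fun n => f (k + n)%N).

Definition suffix_run s (x : run M s) p (px : starts p x) : run M (last s p).
Proof.
apply: (@Run _ _ _ _ (fun n => x (size p + n)%N)) => [|n].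
  by rewrite addn0 -[in last s p]px last_pre ?state0.
by rewrite addnS; exact: state_edge.
Defined.

(* The upper bound holds for [X] and its complement, hence with equality. *)
Section Residual.
Variables (sigma kappa : strategy M) (s : S) (p : seq S).
Hypothesis wE : forall q,
  w sigma s (p ++ q) = w sigma s p * w kappa (last s p) q.

Let Pr_tail_le X : mble X -> tail X ->
  Pr sigma s (X `&` starts p) <= w sigma s p * Pr kappa (last s p) X.
Proof.
move=> mX tX; have mXp : mble (X `&` starts p).
  by apply: mble_setI => //; exact: mble_starts.
have [wp0|wp0] := eqVneq (w sigma s p) 0.
  by rewrite wp0 mul0r -wp0; exact: Pr_startsI_le.
have {wp0}wp0 : 0 < w sigma s p by rewrite lt0r wp0 cylinder_weight_ge0.
rewrite mulrC -ler_pdivrMr// -lee_fin Pr_EFin//.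
apply: le_ereal_inf_tmp => _ [F XF <-].
rewrite -(@lee_pmul2l _ (w sigma s p)%:E)// -EFinM mulrC divfK ?gt_eqF//.
rewrite Pr_EFin//; apply: (@le_trans _ _
    (\esum_(q in F) (w sigma s p * w kappa (last s p) q)%:E)).
  rewrite (eq_esum (b := fun q => (w sigma s (p ++ q))%:E)); last first.
    by move=> q _; rewrite wE.
  rewrite -(esum_image _ (cat p) (fun q => (w sigma s q)%:E)); last first.
    by move=> q r _ _ /eqP; rewrite eqseq_cat// => /andP[_ /eqP].
  (* Prepending [p] to a cover of [X] from [last s p] gives a cover of the part of [X] that starts
     with [p], by [tX]. *)
  apply: ereal_inf_lbound; exists (cat p @` F) => // x [Xx px].
  have [q Fq qx] := XF (suffix_run px) (iffLR (tX _ (size p)) Xx).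
  exists (p ++ q); first by exists q.
  change (pre x (size (p ++ q)) = p ++ q).
  by rewrite size_cat pre_cat px; congr cat; exact: qx.
by apply: esumMl => [|q]; exact: cylinder_weight_ge0.
Qed.

Lemma Pr_tail X : mble X -> tail X ->
  Pr sigma s (X `&` starts p) = w sigma s p * Pr kappa (last s p) X.
Proof.
move=> mX tX; apply/eqP; rewrite eq_le Pr_tail_le//=.
have mC := mble_setC mX.
have := Pr_tail_le mC (fun f k => not_iff_compat (tX f k)).
have := Pr_setID sigma s (@mble_starts _ _ M p) mX.
rewrite Pr_starts ![starts p `&` _]setIC Pr_setC// mulrBr mulr1.
by move=> -> ; lra.
Qed.

End Residual.

(** A strategy has to be given from every start state. Only [last s p] matters here; from the others
    [sigma] is kept, so that the moves remain distributions. *)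
Definition shift_move sigma s p t q :=
  if t == last s p then sigma s (p ++ q) else sigma t q.

Lemma shift_move_distr sigma s p : path (edge M) s p ->
  forall t q, history M t q ->
  is_distr (succs M (last t q)) (shift_move sigma s p t q).
Proof.
move=> sp t q; rewrite /shift_move; case: eqP => [->|_ /move_distr//].
move=> /andP[pq cq]; rewrite -last_cat; apply: move_distr.
by rewrite /history cat_path sp pq last_cat.
Qed.

Definition residual sigma s p (sp : path (edge M) s p) : strategy M :=
  Strategy (shift_move_distr sigma sp).

Lemma residual_weight sigma s p (sp : path (edge M) s p) q :
  w sigma s (p ++ q) = w sigma s p * w (residual sigma sp) (last s p) q.
Proof.
elim/last_ind: q => [|q u IH]; first by rewrite cats0 cylinder_weight_nil mulr1.
rewrite -rcons_cat !cylinder_weight_rcons IH mulrA; congr (_ * _).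
by rewrite /step last_cat /= /shift_move eqxx.
Qed.

Section Switch.
Variables (sigma : strategy M) (s : S) (G : pred (seq S)).
Variable kappa : S -> strategy M.

(** [q] is the part of the history already read, [r] the rest. At the first prefix in [G] the
    strategy that [kappa] assigns to the current state takes over, and it sees only what follows
    that prefix. *)
Fixpoint switch_from q r : S -> R :=
  if G q then kappa (last s q) (last s q) r
  else if r is u :: r' then switch_from (rcons q u) r' else sigma s q.

Definition switch_move t p := if t == s then switch_from [::] p else sigma t p.

Lemma switch_from_distr q r : history M s (q ++ r) ->
  is_distr (succs M (last s (q ++ r))) (switch_from q r).
Proof.
elim: r q => [|u r IH] q /=; rewrite ?last_cat.
  rewrite cats0 => hq; case: ifPn => // _; apply: move_distr => //.
  by move: hq => /andP[_].
move=> hq; case: ifPn => // _; last first.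
  by rewrite -last_cat -cat_rcons; apply: IH; rewrite cat_rcons.
apply: (@move_distr _ _ _ _ _ (u :: r)).
by move: hq; rewrite /history cat_path last_cat -andbA => /and3P[_ -> ->].
Qed.

Lemma switch_move_distr t p : history M t p ->
  is_distr (succs M (last t p)) (switch_move t p).
Proof.
rewrite /switch_move; case: eqP => [->|_ /move_distr//].
exact: (@switch_from_distr [::] p).
Qed.

Definition switch : strategy M := Strategy switch_move_distr.

(** [unhit] counts [p] itself, [unhit_before] only its proper prefixes; thus [unhit_before p]
    together with [G p] says that [p] is the first hit. *)
Definition unhit p := [forall k : 'I_(size p).+1, ~~ G (take k p)].
Definition unhit_before p := [forall k : 'I_(size p), ~~ G (take k p)].

Lemma unhitP p : unhit p <-> (forall k, (k <= size p)%N -> ~~ G (take k p)).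
Proof.
split=> [/forallP h k kp|h]; first exact: (h (Ordinal (kp : k < (size p).+1)%N)).
by apply/forallP => k; apply: h; rewrite -ltnS.
Qed.

Lemma unhit_beforeP p :
  unhit_before p <-> (forall k, (k < size p)%N -> ~~ G (take k p)).
Proof.
split=> [/forallP h k kp|h]; first exact: (h (Ordinal kp)).
by apply/forallP => k; apply: h.
Qed.

Lemma unhit_rcons p u : unhit_before (rcons p u) = unhit p.
Proof.
apply/idP/idP => [/unhit_beforeP h|/unhitP h].
  apply/unhitP => k kp; have := h k; rewrite size_rcons ltnS => /(_ kp).
  by rewrite -cats1 takel_cat.
apply/unhit_beforeP => k; rewrite size_rcons ltnS => kp.
by rewrite -cats1 takel_cat// h.
Qed.

Lemma unhitE p : unhit p = unhit_before p && ~~ G p.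
Proof.
apply/idP/andP => [/unhitP h|[/unhit_beforeP h Gp]].
  split; last by rewrite -[p]take_size h.
  by apply/unhit_beforeP => k /ltnW; exact: h.
apply/unhitP => k; rewrite leq_eqVlt => /predU1P[->|]; last exact: h.
by rewrite take_size.
Qed.

Lemma switch_from_cat p r : unhit_before p ->
  switch_from [::] (p ++ r) = switch_from p r.
Proof.
elim/last_ind: p r => // p u IH r; rewrite unhit_rcons unhitE => /andP[hp Gp].
by rewrite cat_rcons IH//= (negPf Gp).
Qed.

Lemma switch_unhit p : unhit p -> step switch s p = step sigma s p.
Proof.
rewrite unhitE => /andP[hp Gp]; rewrite /step; case: ifP => // _ /=.
by rewrite /switch_move eqxx -[p in LHS]cats0 switch_from_cat//= (negPf Gp).
Qed.

Lemma switch_hit p r : unhit_before p -> G p ->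
  step switch s (p ++ r) = step (kappa (last s p)) (last s p) r.
Proof.
move=> hp Gp; rewrite /step last_cat; case: ifP => // _ /=.
by rewrite /switch_move eqxx switch_from_cat//; case: r => [|u r] /=; rewrite Gp.
Qed.

Lemma switch_weight p : unhit_before p -> w switch s p = w sigma s p.
Proof.
elim/last_ind: p => [|p u IH] hp; first by rewrite !cylinder_weight_nil.
move: hp; rewrite unhit_rcons => hp; rewrite !cylinder_weight_rcons.
by rewrite switch_unhit// IH//; move: hp; rewrite unhitE => /andP[].
Qed.

Lemma switch_weight_cat p r : unhit_before p -> G p ->
  w switch s (p ++ r) = w switch s p * w (kappa (last s p)) (last s p) r.
Proof.
move=> hp Gp; elim/last_ind: r => [|r u IH].
  by rewrite cats0 cylinder_weight_nil mulr1.
by rewrite -rcons_cat !cylinder_weight_rcons IH mulrA switch_hit.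
Qed.

Lemma Pr_switch_hit X p : mble X -> tail X -> unhit_before p -> G p ->
  Pr switch s (X `&` starts p) =
  w sigma s p * Pr (kappa (last s p)) (last s p) X.
Proof.
move=> mX tX hp Gp; rewrite -switch_weight//.
by apply: Pr_tail => // r; exact: switch_weight_cat.
Qed.

Definition never : set (nat -> S) := [set f | forall n, ~~ G (pre f n)].

(** In a cover of [X], every cylinder that meets [never] is [unhit], and there both strategies have
    the same weight. Discarding the other cylinders still leaves a cover and only lowers the sum. *)
Lemma Pr_switch_never X : mble X -> X `<=` never ->
  Pr sigma s X <= Pr switch s X.
Proof.
move=> mX Xn; rewrite -lee_fin !Pr_EFin//.
apply: le_ereal_inf_tmp => _ [F XF <-].
apply: (@le_trans _ _ (\esum_(p in F `&` [set p | unhit p])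
    (w switch s p)%:E)).
  apply: ereal_inf_lbound; exists (F `&` [set p | unhit p]).
    move=> x Xx; have [p Fp px] := XF x Xx; exists p => //; split=> //=.
    apply/unhitP => k kp; rewrite -(starts_take px kp).
    exact: Xn.
  by apply: eq_esum => p [_ /=]; rewrite unhitE => /andP[/switch_weight->].
by apply: esum_subset => [p|p []//]; rewrite lee_fin cylinder_weight_ge0.
Qed.

End Switch.

End Branching.

(** * Value-preserving edges and the zero-one argument *)

Section Value.
Context (R : realType) (S : countType) (M : mdp R S).
Hypothesis fbM : finitely_branching M.
Variable Phi : set (nat -> S).
Hypotheses (mPhi : mble M Phi) (tPhi : tail Phi).
Implicit Types (s t u : S) (p q r : seq S) (f : nat -> S).
Implicit Types X Y : set (nat -> S).
Implicit Types sigma tau kappa : strategy M.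
Implicit Types C : S -> S -> Prop.

Local Notation w := cylinder_weight.
Local Notation succ_seq := (succ_seq fbM).

Definition dirac_move (g : S -> S) s p u : R := (u == g (last s p))%:R.

Lemma dirac_move_distr g : (forall s, edge M s (g s)) ->
  forall s p, history M s p -> is_distr (succs M (last s p)) (dirac_move g s p).
Proof.
move=> gE s p _; split=> [t|t|]; rewrite /dirac_move.
- exact: ler0n.
- by case: eqP => // -> /(_ (gE _)).
- rewrite -[RHS](esum_set1 (t := g (last s p)) (a := fun=> 1%E))//.
  rewrite [RHS]esum_mkcond; apply: eq_esum => u _.
  have [->|ug] := eqVneq u; first by rewrite mem_set.
  by rewrite memNset// => /eqP; rewrite (negPf ug).
Qed.

Definition dirac_strategy g (gE : forall s, edge M s (g s)) : strategy M :=
  Strategy (dirac_move_distr gE).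

Lemma dirac_sum g (gE : forall s, edge M s (g s)) s p (b : S -> R) :
  controlled M (last s p) ->
  \sum_(u <- succ_seq (last s p)) step (dirac_strategy gE) s p u * b u =
  b (g (last s p)).
Proof.
move=> cs; rewrite (bigD1_seq (g (last s p))) ?succ_seq_uniq ?mem_succ_seq//=.
rewrite /step cs /= /dirac_move eqxx mul1r big1 ?addr0// => u ug.
by rewrite (negPf ug) mul0r.
Qed.

Lemma default_edge s : edge M s (default_succ M s).
Proof. exact: xchooseP. Qed.

Definition default_strategy : strategy M := dirac_strategy default_edge.

Definition value s : R := fine (Defs.val (event M Phi s)).

Lemma value_fin s : Defs.val (event M Phi s) \is a fin_num.
Proof.
rewrite fin_numElt; apply/andP; split.
  apply: (@lt_le_trans _ _ (Pr default_strategy s Phi)%:E); first exact: ltNyr.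
  by rewrite Pr_EFin//; apply: ereal_sup_ubound; exists default_strategy.
apply: le_lt_trans (ltry 1); apply: ge_ereal_sup => _ [sigma _ <-].
by rewrite -Pr_EFin// lee_fin Pr_le1.
Qed.

Lemma Pr_le_value sigma s : Pr sigma s Phi <= value s.
Proof.
rewrite -lee_fin Pr_EFin// fineK ?value_fin//.
by apply: ereal_sup_ubound; exists sigma.
Qed.

Lemma value_approx s e : 0 < e -> exists sigma, value s - e < Pr sigma s Phi.
Proof.
move=> e0; have [_ [sigma _ <-]] := ub_ereal_sup_adherent e0 (value_fin s).
by rewrite -[ereal_sup _]fineK ?value_fin// -Pr_EFin// lte_fin => ?; exists sigma.
Qed.

Lemma value_ge0 s : 0 <= value s.
Proof. exact: le_trans (Pr_ge0 default_strategy _ _) (Pr_le_value _ _). Qed.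

Lemma value_le1 s : value s <= 1.
Proof.
rewrite -lee_fin fineK ?value_fin//; apply: ge_ereal_sup => _ [sigma _ <-].
by rewrite -Pr_EFin// lee_fin Pr_le1.
Qed.

Lemma optimalE sigma s :
  optimal sigma (event M Phi s) <-> Pr sigma s Phi = value s.
Proof.
rewrite /optimal -Pr_EFin//; split=> [oE|->].
  by rewrite /value -oE.
by rewrite fineK// value_fin.
Qed.

Lemma Pr_starts_le_value sigma s p :
  Pr sigma s (Phi `&` starts p) <= w sigma s p * value (last s p).
Proof.
have [wp0|/cylinder_weight_path sp] := eqVneq (w sigma s p) 0.
  by rewrite wp0 mul0r -wp0; exact: Pr_startsI_le.
rewrite (Pr_tail (residual_weight sigma sp) mPhi tPhi).
by rewrite ler_wpM2l ?cylinder_weight_ge0// Pr_le_value.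
Qed.

Lemma weight_seq1 sigma s u : w sigma s [:: u] = step sigma s [::] u.
Proof.
by rewrite -[RHS]mul1r -(cylinder_weight_nil sigma s) -cylinder_weight_rcons.
Qed.

(** After one step of [sigma], switch to a strategy that is [e]-optimal from the state reached. *)
Let value_superharmonic0 sigma s :
  \sum_(u <- succ_seq s) step sigma s [::] u * value u <= value s.
Proof.
apply/ler_addgt0Pr => e e0.
have [kappa kappaP] := choice (fun u => value_approx u e0).
pose G q := size q == 1%N.
have hG u : unhit_before G [:: u] by apply/unhit_beforeP => -[|[]].
apply: (@le_trans _ _ (\sum_(u <- succ_seq s)
    step sigma s [::] u * (Pr (kappa u) u Phi + e))).
  by apply: ler_sum => u _; rewrite ler_wpM2l ?step_ge0// ltW// -ltrBlDr.
under eq_bigr do rewrite mulrDr.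
rewrite big_split/= -mulr_suml (@sum_step _ _ _ fbM sigma s [::])// mul1r lerD2r.
apply: le_trans (Pr_le_value (switch sigma s G kappa) s).
rewrite [leRHS](_ : _ = Pr (switch sigma s G kappa) s (Phi `&` starts [::])).
  rewrite (Pr_split fbM)//; apply: ler_sum => u _.
  by rewrite Pr_switch_hit//= weight_seq1.
by apply: eq_Pr => x; split=> [|[]].
Qed.

Lemma value_superharmonic sigma s p : path (edge M) s p ->
  \sum_(u <- succ_seq (last s p)) step sigma s p u * value u <= value (last s p).
Proof.
move=> sp; apply: le_trans (value_superharmonic0 (residual sigma sp) _).
apply: ler_sum => u _; rewrite /step /= /shift_move eqxx cats0.
exact: lexx.
Qed.

Lemma value_edge s u : controlled M s -> edge M s u -> value u <= value s.
Proof.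
move=> cs su; pose g t := if t == s then u else default_succ M t.
have gE t : edge M t (g t).
  by rewrite /g; case: eqP => [->//|_]; exact: default_edge.
have := @value_superharmonic (dirac_strategy gE) s [::] isT.
by rewrite dirac_sum//= /g eqxx.
Qed.

Definition has_optimal s := exists sigma, Pr sigma s Phi = value s.

Lemma sum_le_eq (I : eqType) (l : seq I) (a b : I -> R) :
  {in l, forall i, a i <= b i} -> \sum_(i <- l) b i <= \sum_(i <- l) a i ->
  {in l, forall i, a i = b i}.
Proof.
move=> ab sba i il; apply/eqP; rewrite eq_sym -subr_eq0.
have : \sum_(j <- l) (b j - a j) == 0.
  rewrite eq_le sumrB subr_le0 sba/= subr_ge0 !big_seq.
  exact: ler_sum.
rewrite big_seq psumr_eq0 => [/allP/(_ _ il)|j /ab]; last by rewrite subr_ge0.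
by rewrite il.
Qed.

(** An optimal strategy loses no value on the way. By induction along [p]: each successor
    contributes at most its weight times its value, and by superharmonicity these bounds sum to at
    most the contribution of the parent, so all of them are attained. *)
Lemma optimal_starts sigma s p : Pr sigma s Phi = value s ->
  Pr sigma s (Phi `&` starts p) = w sigma s p * value (last s p) /\
  (w sigma s p != 0 ->
   \sum_(u <- succ_seq (last s p)) step sigma s p u * value u = value (last s p)).
Proof.
move=> os.
have next q : Pr sigma s (Phi `&` starts q) = w sigma s q * value (last s q) ->
    w sigma s q * value (last s q) <=
      \sum_(u <- succ_seq (last s q)) w sigma s (rcons q u) * value u.
  move=> <-; rewrite (Pr_split fbM)//; apply: ler_sum => u _.
  by have := Pr_starts_le_value sigma s (rcons q u); rewrite last_rcons.
have rE q : w sigma s q != 0 ->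
    \sum_(u <- succ_seq (last s q)) w sigma s (rcons q u) * value u <=
    w sigma s q * value (last s q).
  move=> /cylinder_weight_path sq.
  under eq_bigr do rewrite cylinder_weight_rcons -mulrA.
  by rewrite -mulr_sumr ler_wpM2l ?cylinder_weight_ge0// value_superharmonic.
have pE : Pr sigma s (Phi `&` starts p) = w sigma s p * value (last s p).
  elim/last_ind: p => [|p u IH].
    rewrite cylinder_weight_nil mul1r -os; apply: eq_Pr => x; by split=> [[]|].
  have [wpu|wpu] := eqVneq (w sigma s (rcons p u)) 0.
    apply/eqP; rewrite wpu mul0r eq_le Pr_ge0 andbT -wpu.
    exact: Pr_startsI_le.
  have wp : w sigma s p != 0.
    by move: wpu; rewrite cylinder_weight_rcons mulf_eq0 negb_or => /andP[].
  rewrite last_rcons; apply: (sum_le_eq (l := succ_seq (last s p))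
    (a := fun u => Pr sigma s (Phi `&` starts (rcons p u)))
    (b := fun u => w sigma s (rcons p u) * value u)).
  - move=> v _; have := Pr_starts_le_value sigma s (rcons p v).
    by rewrite last_rcons.
  - by rewrite -(Pr_split fbM)// IH; exact: rE.
  - rewrite mem_succ_seq; move/cylinder_weight_path: wpu.
    by rewrite rcons_path => /andP[].
split=> // wp; apply/eqP; rewrite eq_le value_superharmonic//=; last first.
  exact: cylinder_weight_path wp.
have wp0 : 0 < w sigma s p by rewrite lt0r wp cylinder_weight_ge0.
rewrite -(ler_pM2l wp0) mulr_sumr; apply: le_trans (next _ pE) _.
by apply: ler_sum => u _; rewrite cylinder_weight_rcons mulrA.
Qed.

Lemma optimal_suffix sigma s p : Pr sigma s Phi = value s ->
  w sigma s p != 0 -> has_optimal (last s p).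
Proof.
move=> os wp; have sp := cylinder_weight_path wp.
exists (residual sigma sp); apply: (mulfI wp).
rewrite -(Pr_tail (residual_weight sigma sp) mPhi tPhi).
by case: (optimal_starts p os).
Qed.

Definition conforms C sigma s := forall p u, w sigma s (rcons p u) != 0 ->
  controlled M (last s p) -> C (last s p) u.

Definition preserving C := forall t u,
  controlled M t -> has_optimal t -> C t u -> has_optimal u /\ value u = value t.

(** States without an optimal strategy are left unconstrained, which keeps the relation serial. *)
Definition optimal_edge t u :=
  has_optimal t -> has_optimal u /\ value u = value t.

(** At a controlled state no successor has a larger value, while the average over the move of
    [sigma] equals the present value; so every successor chosen with positive probability has that
    same value. *)
Lemma optimal_conforms sigma s : Pr sigma s Phi = value s ->
  conforms optimal_edge sigma s.
Proof.
move=> os p u wpu cp _; split.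
  by have := optimal_suffix os wpu; rewrite last_rcons.
have [wp0 st0] : w sigma s p != 0 /\ step sigma s p u != 0.
  by move: wpu; rewrite cylinder_weight_rcons mulf_eq0 negb_or => /andP[].
have sp := cylinder_weight_path wp0.
have [_ /(_ wp0) vE] := optimal_starts p os.
apply: (mulfI st0); apply: (sum_le_eq (l := succ_seq (last s p))
  (a := fun u => step sigma s p u * value u)
  (b := fun u => step sigma s p u * value (last s p))).
- move=> x; rewrite mem_succ_seq => /(value_edge cp) xp.
  by rewrite ler_wpM2l// step_ge0.
- by rewrite vE -mulr_suml sum_step// mul1r.
- rewrite mem_succ_seq; move/cylinder_weight_path: wpu.
  by rewrite rcons_path => /andP[].
Qed.

Lemma weight_rcons_neq0 sigma s p u : w sigma s (rcons p u) != 0 ->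
  w sigma s p != 0 /\ step sigma s p u != 0.
Proof. by rewrite cylinder_weight_rcons mulf_eq0 negb_or => /andP[]. Qed.

Lemma step_random sigma tau s p : ~~ controlled M (last s p) ->
  step sigma s p = step tau (last s p) [::].
Proof. by rewrite /step /= => /negPf->. Qed.

(** Controlled steps are covered by [preserving]. A random step is the same under every strategy,
    hence also under an optimal one, to which [optimal_suffix] applies. *)
Lemma conforms_has_optimal C sigma s p : preserving C -> has_optimal s ->
  conforms C sigma s -> w sigma s p != 0 -> has_optimal (last s p).
Proof.
move=> pC os cC; elim/last_ind: p => // p u IH wpu; rewrite last_rcons.
have [wp st] := weight_rcons_neq0 wpu; have op := IH wp.
have [cp|cp] := boolP (controlled M (last s p)).
  by have [] := pC _ _ cp op (cC _ _ wpu cp).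
have [tau ot] := op; apply: (optimal_suffix (p := [:: u]) ot).
by rewrite weight_seq1 -(step_random sigma).
Qed.

Lemma value_harmonic C sigma s p : preserving C -> has_optimal s ->
  conforms C sigma s -> w sigma s p != 0 ->
  \sum_(u <- succ_seq (last s p)) step sigma s p u * value u = value (last s p).
Proof.
move=> pC os cC wp; have op := conforms_has_optimal pC os cC wp.
have [cp|cp] := boolP (controlled M (last s p)); last first.
  have [tau ot] := op; rewrite (step_random _ tau)//.
  have [_ /(_ _)->//] := optimal_starts [::] ot.
  by rewrite cylinder_weight_nil oner_neq0.
rewrite -[RHS]mul1r -(sum_step fbM sigma (cylinder_weight_path wp)) mulr_suml.
apply: eq_bigr => u _; have [->|st] := eqVneq (step sigma s p u) 0.
  by rewrite !mul0r.
congr (_ * _); have [] // := pC _ u cp op; apply: cC => //.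
by rewrite cylinder_weight_rcons mulf_neq0.
Qed.

Section SwitchValue.
Variables (sigma : strategy M) (s : S) (G : pred (seq S)).
Variable kappa : S -> strategy M.
Local Notation rho := (switch sigma s G kappa).

Lemma mble_never : mble M (never G).
Proof.
rewrite (_ : never G = \bigcap_n [set f | ~~ G (pre f n)]).
  by apply: mble_bigcap => n; exact: (@mble_pre _ _ M (fun=> [set p | ~~ G p]) n).
by apply/seteqP; split=> f fG n //=; exact: fG.
Qed.

(* The potential [a] is cashed in when [G] is hit; [c * Pr (Y & never G)] bounds
   the part of it that never is. *)
Lemma switch_ge (a : seq S -> R) (c : R) Y : mble M Y -> 0 < c ->
  (forall p, unhit G p ->
     a p <= \sum_(u <- succ_seq (last s p)) a (rcons p u)) ->
  (forall p, unhit_before G p -> G p -> a p <= Pr rho s (Phi `&` starts p)) ->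
  (forall p, unhit G p -> a p <= c * Pr sigma s (Y `&` starts p)) ->
  a [::] - c * Pr sigma s (Y `&` never G) + Pr sigma s (Phi `&` never G)
    <= Pr rho s Phi.
Proof.
move=> mY c0 aS aG aY; pose U n : set (nat -> S) := [set f | unhit G (pre f n)].
have mN := mble_never; have mU n : mble M (U n).
  exact: (@mble_pre _ _ M (fun=> [set p | unhit G p]) n).
have mPN : mble M (Phi `&` never G) by exact: mble_setI.
have mYU n : mble M (Y `&` U n) by exact: mble_setI.
(* [d] is the goal solved for [Pr sigma s (Y & never G)]; continuity from above then reduces it to
   the finite-horizon sets [U n]. *)
pose d := (a [::] - Pr rho s Phi + Pr sigma s (Phi `&` never G)) / c.
suff : d <= Pr sigma s (Y `&` never G).
  by rewrite ler_pdivrMr// mulrC; lra.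
rewrite (@eq_Pr _ _ _ _ _ _ (\bigcap_n (Y `&` U n))); last first.
  move=> x; split=> [[Yx Nx] n _|h].
    by split=> //; apply/unhitP => k; rewrite size_pre => kn; rewrite pre_take.
  split=> [|n]; first by have [] := h 0%N I.
  by have [_ /unhitP/(_ n)] := h n I; rewrite size_pre pre_take// => ->.
apply: Pr_bigcap_ge => // [n f [Yf /unhitP Uf]|n].
  split=> //; apply/unhitP => k; rewrite size_pre => kn.
  have := Uf k; rewrite size_pre !pre_take//; last exact: leqW.
  by apply; exact: leqW.
rewrite ler_pdivrMr// mulrC.
(* [b] is additive over successors. It dominates [a] at a first hit, where its middle term vanishes,
   and at depth [n] without a hit, where [starts p] lies in [U n] and [Pr_switch_never] makes the
   difference of the first two terms nonnegative. *)
pose b p := Pr rho s (Phi `&` starts p) - Pr sigma s (Phi `&` never G `&` starts p)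
  + c * Pr sigma s (Y `&` U n `&` starts p).
suff : (if unhit_before G [::] then a [::] else b [::]) <= b [::].
  rewrite (_ : unhit_before G [::]); last by apply/unhit_beforeP.
  have T X tau : Pr tau s (X `&` starts [::]) = Pr tau s X.
    by apply: eq_Pr => x; split=> [[]|].
  by rewrite /b !T; lra.
(* Past the first hit the compared function is [b] itself, so that nothing remains to be shown
   there. *)
apply: (@le_horizon _ _ _ fbM s (fun p => if unhit_before G p then a p else b p) b n).
  move=> p _; rewrite /b !(Pr_split fbM _ _ p)// mulr_sumr -sumrB -big_split/=.
  exact: lexx.
move=> p pn; case: ifPn => hp; last by left.
have [Gp|Gp] := boolP (G p).
  left; apply: le_trans (aG _ hp Gp) _.
  rewrite /b [X in _ - X](_ : _ = 0) ?subr0.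
    by rewrite lerDl mulr_ge0// ?Pr_ge0// ltW.
  by apply: Pr_eq0 => x [[_ Nx] px]; have := Nx (size p); rewrite px Gp.
have up : unhit G p by rewrite unhitE hp.
move: pn; rewrite leq_eqVlt => /predU1P[pn|pn]; [left|right]; last first.
  split=> //; apply: le_trans (aS _ up) _; apply: ler_sum => u _.
  by rewrite unhit_rcons up.
apply: le_trans (aY _ up) _; rewrite /b -[leLHS]add0r; apply: lerD.
  rewrite subr_ge0; apply: (@le_trans _ _ (Pr rho s (Phi `&` never G `&` starts p))).
    apply: Pr_switch_never => [|f [[]]//].
    by apply: mble_setI => //; exact: mble_starts.
  by apply: le_Pr => [||x [[]]//]; apply: mble_setI => //; exact: mble_starts.
rewrite (ler_pM2l c0); apply: le_Pr.
- by apply: mble_setI => //; exact: mble_starts.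
- by apply: mble_setI => //; exact: mble_starts.
- by move=> x [Yx px]; split=> //; split=> //; rewrite /U/= -pn px.
Qed.

Lemma switch_conforms C :
  (forall p u, unhit G p -> w sigma s (rcons p u) != 0 ->
     controlled M (last s p) -> C (last s p) u) ->
  (forall p, unhit_before G p -> G p -> w sigma s p != 0 ->
     conforms C (kappa (last s p)) (last s p)) ->
  conforms C rho s.
Proof.
move=> cs ck p u wpu cp; have [up|] := boolP (unhit G p).
  by apply: cs => //; move: wpu; rewrite switch_weight// unhit_rcons.
rewrite negb_forall => /existsP[k0 Gk0].
have ex : exists k, (k <= size p)%N && G (take k p).
  by exists k0; rewrite -ltnS ltn_ord/= -[G _]negbK.
(* [k] is the length of the first prefix of [p] in [G]: up to it the weight is that of [sigma],
   after it that of [kappa]. *)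
case: (ex_minnP ex) => k /andP[kp Gk] kmin.
have hk : unhit_before G (take k p).
  apply/unhit_beforeP => i; rewrite size_takel// => ik; rewrite take_takel 1?ltnW//.
  apply/negP => Gi; have := kmin i; rewrite Gi andbT => /(_ (leq_trans (ltnW ik) kp)).
  by rewrite leqNgt ik.
move: wpu; rewrite -[in X in rcons X u](cat_take_drop k p) rcons_cat.
rewrite switch_weight_cat// mulf_eq0 negb_or switch_weight// => /andP[wk wd].
have lE : last s p = last (last s (take k p)) (drop k p).
  by rewrite -last_cat cat_take_drop.
by rewrite lE; apply: (ck _ hk Gk wk) => //; rewrite -lE.
Qed.

End SwitchValue.

(** By contradiction: were the supremum over conforming strategies at most [value s - e], restarting
    an almost best one when it seems to fail would exceed that supremum. *)
Lemma near_optimal C c : preserving C -> 0 < c < 1 ->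
  (forall t, has_optimal t ->
     exists kappa, conforms C kappa t /\ c * value t <= Pr kappa t Phi) ->
  forall s e, has_optimal s -> 0 < e ->
    exists sigma, conforms C sigma s /\ value s - e < Pr sigma s Phi.
Proof.
move=> pC /andP[c0 c1] hC s e os e0.
have [kappa kappaP] : {kappa : S -> strategy M & forall t, has_optimal t ->
    conforms C (kappa t) t /\ c * value t <= Pr (kappa t) t Phi}.
  apply: (choice (P := fun t kappa => has_optimal t ->
    conforms C kappa t /\ c * value t <= Pr kappa t Phi)) => t.
  have [/hC[kappa ?]|nt] := pselect (has_optimal t).
    by exists kappa.
  by exists default_strategy.
pose A := [set Pr sigma s Phi | sigma in [set sigma | conforms C sigma s]].
have supA : has_sup A.
  split; first by have [ks _] := kappaP s os; exists (Pr (kappa s) s Phi), (kappa s).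
  by exists 1 => _ [sigma _ <-]; exact: Pr_le1.
have [se|se] := ltP (value s - e) (sup A).
  have [|_ [sigma csigma <-] sE] := @sup_adherent _ A (sup A - (value s - e)) _ supA.
    by rewrite subr_gt0.
  by exists sigma; split=> //; move: sE; rewrite opprB addrC subrK.
(* [sigma] may be [d] below the supremum and the cover [d] too heavy. These losses enter with factor
   [1 - c], and for this [d] they stay below the gain [c * e]. *)
exfalso; pose d := c * e / 4; have d0 : 0 < d by rewrite /d divr_gt0// mulr_gt0.
have [_ [sigma csigma <-] sE] := sup_adherent d0 supA.
have [_ [F PhiF <-] FE] : exists2 x : \bar R,
    [set (\esum_(p in F) (w sigma s p)%:E)%E | F in [set F |
       event M (~` Phi) s `<=` \bigcup_(p in F) @cylinder _ _ M s p]] x &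
    (x < run_prob sigma (event M (~` Phi) s) + d%:E)%E.
  apply: lb_ereal_inf_adherent => //.
  by rewrite -[ereal_inf _]/(run_prob sigma _) -Pr_EFin//; exact: mble_setC.
(* A hit means that the run has entered a cylinder of the cover [F] of the complement of [Phi]; a
   run that is never hit therefore satisfies [Phi]. *)
pose G : pred (seq S) := fun p => `[< F p >].
have mN := mble_never G.
have NPhi (x : run M s) : never G x -> Phi x.
  move=> Nx; apply: contrapT => /PhiF[p Fp px]; have := Nx (size p).
  by rewrite [pre _ _]px => /negP; apply; exact/asboolP.
have PrN : Pr sigma s Phi - d <= Pr sigma s (never G).
  have : Pr sigma s (~` never G) <= Pr sigma s (~` Phi) + d.
    rewrite -lee_fin EFinD !Pr_EFin; try exact: mble_setC.
    apply: le_trans (ltW FE); apply: ereal_inf_lbound; exists F => // x /existsNP[n].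
    move=> /negP; rewrite negbK => /asboolP Fn; exists (pre x n) => //.
    exact: starts_pre.
  by rewrite !Pr_setC//; lra.
have csw : conforms C (switch sigma s G kappa) s.
  apply: switch_conforms => [p u _|p _ _ wp]; first exact: csigma.
  by have [] := kappaP _ (conforms_has_optimal pC os csigma wp).
(* The potential is [c] times the value, a martingale under [sigma], and [kappa] collects it at a
   hit. As values are at most 1, the part never collected is at most [c * Pr sigma s (never G)]. *)
have := @switch_ge sigma s G kappa
  (fun p => c * (w sigma s p * value (last s p))) c setT (@mble_setT _ _ M) c0.
have PhiN : Pr sigma s (Phi `&` never G) = Pr sigma s (never G).
  by apply: eq_Pr => x; split=> [[]//|Nx]; split=> //; exact: NPhi.
rewrite setTI PhiN cylinder_weight_nil mul1r /= => /(_ _ _ _).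
have le_sup : Pr (switch sigma s G kappa) s Phi <= sup A.
  by apply: ub_le_sup => //; [case: supA|exists (switch sigma s G kappa)].
move=> h; have /h{h} h : forall p, unhit G p ->
    c * (w sigma s p * value (last s p)) <= \sum_(u <- succ_seq (last s p))
      c * (w sigma s (rcons p u) * value (last s (rcons p u))).
  move=> p _; rewrite -mulr_sumr (ler_pM2l c0).
  have [->|wp] := eqVneq (w sigma s p) 0.
    rewrite mul0r sumr_ge0// => u _.
    by rewrite mulr_ge0 ?cylinder_weight_ge0 ?value_ge0.
  rewrite -(value_harmonic pC os csigma wp) mulr_sumr; apply: ler_sum => u _.
  by rewrite cylinder_weight_rcons last_rcons mulrA.
have /h{h} h : forall p, unhit_before G p -> G p ->
    c * (w sigma s p * value (last s p)) <=
    Pr (switch sigma s G kappa) s (Phi `&` starts p).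
  move=> p hp Gp; rewrite Pr_switch_hit// mulrCA.
  have [->|wp] := eqVneq (w sigma s p) 0; first by rewrite !mul0r.
  rewrite ler_wpM2l ?cylinder_weight_ge0//.
  by have [] := kappaP _ (conforms_has_optimal pC os csigma wp).
have {}h : c * value s - c * Pr sigma s (never G) + Pr sigma s (never G) <= sup A.
  apply: le_trans le_sup; apply: h => p _.
  rewrite setTI Pr_starts (ler_pM2l c0) ler_piMr ?cylinder_weight_ge0//.
  exact: value_le1.
have dE : 4 * d = c * e by rewrite /d mulrC divfK.
have h1 : (1 - c) * (sup A - 2 * d) <= (1 - c) * Pr sigma s (never G).
  by rewrite ler_wpM2l ?subr_ge0 ?ltW//; lra.
have h2 : c * (sup A) <= c * (value s - e) by rewrite ler_pM2l.
have h3 : 0 < c * d by rewrite mulr_gt0.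
nra.
Qed.

End Value.

(** * Maximal survival probability *)

Section Discount.
Context (R : realType) (S : countType) (M : mdp R S).
Hypothesis fbM : finitely_branching M.
Variable Phi : set (nat -> S).
Hypotheses (mPhi : mble M Phi) (tPhi : tail Phi).
Variable x : S -> S -> R.
Hypotheses (x_gt0 : forall t u, 0 < x t u) (x_le1 : forall t u, x t u <= 1).
Implicit Types (s t u : S) (p q r : seq S) (f : nat -> S).
Implicit Types X Y : set (nat -> S).
Implicit Types sigma tau kappa : strategy M.

Local Notation w := cylinder_weight.
Local Notation succ_seq := (succ_seq fbM).
Local Notation value := (value M Phi).
Local Notation has_optimal := (has_optimal M Phi).
Local Notation preserving := (preserving M Phi).

(** With [x t u] read as the probability of surviving the edge from [t] to [u], this is the
    probability of surviving all of [p]. *)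
Fixpoint discount s p : R :=
  if p is u :: p' then x s u * discount u p' else 1.

Lemma discount_rcons s p u :
  discount s (rcons p u) = discount s p * x (last s p) u.
Proof.
by elim: p s => [|v p IH] s /=; rewrite ?mulr1 ?mul1r// IH mulrA.
Qed.

Lemma discount_gt0 s p : 0 < discount s p.
Proof. by elim: p s => //= v p IH s; rewrite mulr_gt0. Qed.

Lemma discount_le1 s p : discount s p <= 1.
Proof.
elim: p s => //= v p IH s; rewrite mulr_ile1//; apply: ltW => //.
exact: discount_gt0.
Qed.

Hypothesis discount_Phi : forall f (d : R), 0 < d ->
  (forall n, d <= discount (f 0%N) (pre f n)) -> Phi f.

(** At depth [n] the discounted weight is at most the weight inside [B n] and at most [d] times the
    weight outside, so [a [::] <= Pr tau s (B n) + d]. Runs that lie in every [B n] satisfy [Phi],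
    and [d] is arbitrary. *)
Lemma Pr_ge_potential tau s (a : seq S -> R) :
  (forall p, a p <= w tau s p * discount s p) ->
  (forall p, a p <= 0 \/ a p <= \sum_(u <- succ_seq (last s p)) a (rcons p u)) ->
  a [::] <= Pr tau s Phi.
Proof.
move=> aw aS; apply/ler_addgt0Pr => d d0; rewrite -lerBlDr.
pose B n : set (nat -> S) := [set f | d <= discount s (pre f n)].
have mB n : mble M (B n).
  exact: (@mble_pre _ _ M (fun=> [set p | d <= discount s p]) n).
apply: (@le_trans _ _ (Pr tau s (\bigcap_n B n))); last first.
  apply: le_Pr => // [|f Bf]; first exact: mble_bigcap.
  by apply: (discount_Phi d0) => n; rewrite state0; exact: Bf.
apply: Pr_bigcap_ge => // n.
  move=> f /le_trans; apply; rewrite preS discount_rcons.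
  by rewrite ler_piMr// ltW// discount_gt0.
rewrite lerBlDr; pose b p := Pr tau s (B n `&` starts p) + w tau s p * d.
have -> : Pr tau s (B n) + d = b [::].
  rewrite /b cylinder_weight_nil mul1r; congr (_ + _).
  by apply: eq_Pr => f; split=> [|[]].
apply: (@le_horizon _ _ _ fbM s a b n) => p pn.
  rewrite /b big_split/= -mulr_suml.
  by rewrite -(Pr_split fbM)// -weight_split.
have b0 : 0 <= b p by rewrite addr_ge0 ?Pr_ge0// mulr_ge0 ?cylinder_weight_ge0// ltW.
have [a0|aSp] := aS p; first by left; exact: le_trans b0.
move: pn; rewrite leq_eqVlt => /predU1P[pn|]; last by right.
left; apply: le_trans (aw p) _; rewrite /b.
have [dp|/ltW dp] := leP d (discount s p); last first.
  by apply: ler_wpDl; rewrite ?Pr_ge0// ler_wpM2l ?cylinder_weight_ge0.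
apply: ler_wpDr; first by rewrite mulr_ge0 ?cylinder_weight_ge0// ltW.
rewrite (@eq_Pr _ _ _ _ _ _ (starts p)) ?Pr_starts.
  by rewrite ler_piMr ?cylinder_weight_ge0// discount_le1.
by move=> f; split=> [[]//|pf]; split=> //; rewrite /B/= -pn pf.
Qed.

Variable C : S -> S -> Prop.
Hypothesis C_serial : forall t, controlled M t -> exists2 u, edge M t u & C t u.

(** Optimality operator of the survival problem with moves restricted to [C]. The base point 0 of
    the maximum is harmless: [g] is nonnegative where this is applied, and [C_serial] provides an
    admissible edge. *)
Definition bellman (g : S -> R) t : R :=
  if controlled M t then
    \big[Num.max/0]_(u <- succ_seq t | `[< C t u >]) (x t u * g u)
  else \sum_(u <- succ_seq t) prob M t u * (x t u * g u).

Lemma prob_ge0 t u : ~~ controlled M t -> 0 <= prob M t u.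
Proof. by move=> /prob_distr[]. Qed.

Lemma sum_prob t : ~~ controlled M t -> \sum_(u <- succ_seq t) prob M t u = 1.
Proof. by move=> /prob_distr; exact: distr_sum. Qed.

Lemma bellman_ge0 g t : (forall u, 0 <= g u) -> 0 <= bellman g t.
Proof.
move=> g0; rewrite /bellman; case: ifPn => ct; first exact: bigmax_ge_id.
by apply: sumr_ge0 => u _; rewrite !mulr_ge0 ?prob_ge0// ltW.
Qed.

Lemma bellman_controlled g t u : controlled M t -> edge M t u -> C t u ->
  x t u * g u <= bellman g t.
Proof.
move=> ct tu Cu; rewrite /bellman ct.
apply: (le_bigmax_seq 0 u (fun u => `[< C t u >]) (fun u => x t u * g u)).
  by rewrite mem_succ_seq.
exact/asboolP.
Qed.

(** The operator is monotone and, as [x] is at most 1, nonexpansive. The comparison is asked for on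
    the successors of [t] only, a finite set. *)
Lemma le_bellmanD g h t e : 0 <= e -> (forall u, 0 <= h u) ->
  {in succ_seq t, forall u, g u <= h u + e} -> bellman g t <= bellman h t + e.
Proof.
move=> e0 h0 gh.
have xgh u : u \in succ_seq t -> x t u * g u <= x t u * h u + e.
  move=> ut; apply: (@le_trans _ _ (x t u * (h u + e))).
    by rewrite ler_wpM2l ?gh// ltW.
  by rewrite mulrDr lerD2l ler_piMl.
rewrite {1}/bellman; case: ifPn => ct.
  rewrite big_seq_cond; apply: bigmax_le; first by rewrite addr_ge0// bellman_ge0.
  move=> u /andP[ut /asboolP Cu]; apply: le_trans (xgh _ ut) _; rewrite lerD2r.
  by apply: bellman_controlled => //; rewrite -(mem_succ_seq fbM).
rewrite /bellman (negPf ct).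
rewrite -[X in _ + X]mul1r -(sum_prob ct) mulr_suml -big_split/=.
rewrite !big_seq; apply: ler_sum => u ut; rewrite -mulrDr.
by rewrite ler_wpM2l ?prob_ge0// xgh.
Qed.

Lemma bellman_attained g t : (forall u, 0 <= g u) -> controlled M t ->
  exists u, [/\ edge M t u, C t u & bellman g t <= x t u * g u].
Proof.
move=> g0 ct; apply: contrapT => /forallNP nu.
have lt u : edge M t u -> C t u -> x t u * g u < bellman g t.
  by move=> tu Cu; rewrite ltNge; apply/negP => ?; apply: (nu u); split.
have [u0 tu0 Cu0] := C_serial ct.
have : bellman g t < bellman g t; last by rewrite ltxx.
rewrite {1}/bellman ct big_seq_cond; apply: bigmax_lt.
  by apply: le_lt_trans (lt _ tu0 Cu0); rewrite mulr_ge0// ltW.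
by move=> u /andP[]; rewrite mem_succ_seq => tu /asboolP; exact: lt.
Qed.

Definition horizon_value n : S -> R := iter n bellman (fun=> 1).

Lemma horizon_value_ge0 n t : 0 <= horizon_value n t.
Proof. by elim: n t => //= n IH t; exact: bellman_ge0. Qed.

Lemma horizon_valueS n t : horizon_value n.+1 t <= horizon_value n t.
Proof.
elim: n t => [|n IH] t; last first.
  rewrite -[leRHS]addr0; apply: le_bellmanD => // [u|u _].
    exact: horizon_value_ge0.
  by rewrite addr0; exact: IH.
rewrite /= /bellman; case: ifPn => ct.
  by apply: bigmax_le => // u _; rewrite mulr1.
rewrite -[leRHS](sum_prob ct); apply: ler_sum => u _.
by rewrite mulr1 ler_piMr ?prob_ge0.
Qed.

Lemma horizon_value_le m n t :
  (m <= n)%N -> horizon_value n t <= horizon_value m t.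
Proof.
move=> /subnKC <-; elim: (n - m)%N => [|k IH]; first by rewrite addn0.
by rewrite addnS (le_trans (horizon_valueS _ _)).
Qed.

Definition safety_value t : R := inf [set horizon_value n t | n in setT].

Let has_inf_horizon t : has_inf [set horizon_value n t | n in setT].
Proof.
split; first by exists (horizon_value 0 t), 0%N.
by exists 0 => _ [n _ <-]; exact: horizon_value_ge0.
Qed.

Lemma safety_value_le n t : safety_value t <= horizon_value n t.
Proof. by apply: ge_inf; [case: (has_inf_horizon t)|exists n]. Qed.

Lemma safety_value_ge t b :
  (forall n, b <= horizon_value n t) -> b <= safety_value t.
Proof.
move=> h; apply: lb_le_inf; first by case: (has_inf_horizon t).
by move=> _ [n _ <-].
Qed.

Lemma safety_value_ge0 t : 0 <= safety_value t.
Proof. by apply: safety_value_ge => n; exact: horizon_value_ge0. Qed.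

Lemma safety_value_le1 t : safety_value t <= 1.
Proof. exact: (safety_value_le 0). Qed.

Lemma safety_value_approx (l : seq S) e : 0 < e ->
  exists n, {in l, forall u, horizon_value n u <= safety_value u + e}.
Proof.
move=> e0; elim: l => [|t l [n nl]]; first by exists 0%N.
have [_ [m _ <-] /ltW mt] := inf_adherent e0 (has_inf_horizon t).
exists (maxn m n) => u; rewrite inE => /predU1P[->|/nl nu].
  by apply: le_trans mt; apply: horizon_value_le; exact: leq_maxl.
by apply: le_trans nu; apply: horizon_value_le; exact: leq_maxr.
Qed.

(** Finite branching enters here: one horizon approximates the infimum at all successors of [t] at
    once, so the infimum passes through the maximum. *)
Lemma safety_value_bellman t : safety_value t <= bellman safety_value t.
Proof.
apply/ler_addgt0Pr => e e0; have [n nt] := safety_value_approx (succ_seq t) e0.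
apply: le_trans (safety_value_le n.+1 t) _; apply: le_bellmanD => //; first exact: ltW.
exact: safety_value_ge0.
Qed.

Lemma sum_step_le_bellman sigma s p g : (forall u, 0 <= g u) ->
  conforms C sigma s -> w sigma s p != 0 ->
  \sum_(u <- succ_seq (last s p)) step sigma s p u * (x (last s p) u * g u)
    <= bellman g (last s p).
Proof.
move=> g0 cC wp; have sp := cylinder_weight_path wp.
have [cp|cp] := boolP (controlled M (last s p)); last first.
  by rewrite /bellman /step (negPf cp).
rewrite -[leRHS]mul1r -(sum_step fbM sigma sp) mulr_suml.
rewrite !big_seq; apply: ler_sum => u pu.
have [->|st] := eqVneq (step sigma s p u) 0; first by rewrite !mul0r.
rewrite ler_wpM2l ?step_ge0//; apply: bellman_controlled => //.
  by rewrite -(mem_succ_seq fbM).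
by apply: cC => //; rewrite cylinder_weight_rcons mulf_neq0.
Qed.

(** For each horizon, weight times discount times remaining horizon value is a supermartingale along
    [sigma]. At the horizon it dominates [c * Pr sigma s (Y & starts p)], because a prefix with
    discount below [c] starts no run of [Y]. *)
Lemma safety_value_ge_Pr sigma s (c : R) Y :
  mble M Y -> 0 <= c -> conforms C sigma s ->
  (forall f : run M s, Y f -> forall n, c <= discount s (pre f n)) ->
  c * Pr sigma s Y <= safety_value s.
Proof.
move=> mY c0 cC Yc; apply: safety_value_ge => n.
pose a p := c * Pr sigma s (Y `&` starts p).
pose b p := w sigma s p * (discount s p * horizon_value (n - size p) (last s p)).
have -> : c * Pr sigma s Y = a [::].
  by congr (c * _); apply: eq_Pr => f; split=> [|[]].
have -> : horizon_value n s = b [::].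
  by rewrite /b cylinder_weight_nil !mul1r/= subn0.
apply: (@le_horizon _ _ _ fbM s a b n) => p pn; rewrite /a /b.
  have [wp|wp] := eqVneq (w sigma s p) 0.
    by rewrite wp mul0r big1// => u _; rewrite cylinder_weight_rcons wp !mul0r.
  have -> : (n - size p = (n - (size p).+1).+1)%N by rewrite subnSK.
  have hB := sum_step_le_bellman (horizon_value_ge0 (n - (size p).+1)) cC wp.
  have dB := ler_wpM2l (ltW (discount_gt0 s p)) hB.
  apply: le_trans (ler_wpM2l (cylinder_weight_ge0 sigma s p) dB).
  rewrite !mulr_sumr; apply: ler_sum => u _; rewrite size_rcons last_rcons.
  by rewrite cylinder_weight_rcons discount_rcons; lra.
move: pn; rewrite leq_eqVlt => /predU1P[pn|pn]; last first.
  by right; split=> //; rewrite (Pr_split fbM)// mulr_sumr.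
left; rewrite -pn subnn mulr1.
have [cp|cp] := leP c (discount s p).
  rewrite mulrC; apply: ler_pM => //; first exact: Pr_ge0.
  exact: Pr_startsI_le.
rewrite Pr_eq0 ?mulr0 ?mulr_ge0 ?cylinder_weight_ge0 ?ltW ?discount_gt0//.
by move=> f [/Yc/(_ n)]; rewrite -pn => + pf; rewrite pf leNgt cp.
Qed.

Lemma conserving_exists : exists g, forall t, edge M t (g t) /\
  (controlled M t -> C t (g t) /\ safety_value t <= x t (g t) * safety_value (g t)).
Proof.
have : {g & forall t, edge M t (g t) /\
    (controlled M t -> C t (g t) /\ safety_value t <= x t (g t) * safety_value (g t))}.
  apply: (choice (P := fun t u => edge M t u /\
    (controlled M t -> C t u /\ safety_value t <= x t u * safety_value u))) => t.
  have [ct|ct] := boolP (controlled M t); last first.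
    by exists (default_succ M t); split=> //; exact: default_edge.
  have [u [tu Cu vu]] := bellman_attained safety_value_ge0 ct.
  exists u; split=> // _; split=> //; apply: le_trans vu.
  exact: safety_value_bellman.
by case=> g gP; exists g.
Qed.

End Discount.

(** * Fixing a conserving strategy on a region *)

Section Restrict.
Context (R : realType) (S : countType) (M : mdp R S).
Hypothesis fbM : finitely_branching M.
Variable Phi : set (nat -> S).
Hypotheses (mPhi : mble M Phi) (tPhi : tail Phi).
Implicit Types (s t u : S) (p q r : seq S) (f : nat -> S).
Implicit Types X Y : set (nat -> S).
Implicit Types sigma tau kappa : strategy M.
Implicit Types C : S -> S -> Prop.

Local Notation w := cylinder_weight.
Local Notation succ_seq := (succ_seq fbM).
Local Notation value := (value M Phi).
Local Notation has_optimal := (has_optimal M Phi).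
Local Notation preserving := (preserving M Phi).

Definition serial C :=
  forall t, controlled M t -> exists2 u, edge M t u & C t u.

(** The fraction [4^-1] reproduces itself in [restrict_at]: a strategy within a quarter of the value
    is taken, and a third of its probability is kept. *)
Definition quarter_optimal C := forall t, has_optimal t ->
  exists kappa, conforms C kappa t /\ 4^-1 * value t <= Pr kappa t Phi.

Lemma dirac_conforms C g (gE : forall s, edge M s (g s)) s :
  (forall t, controlled M t -> C t (g t)) -> conforms C (dirac_strategy gE) s.
Proof.
move=> Cg p u /weight_rcons_neq0[_ st] cp; move: st.
rewrite /step cp /= /dirac_move.
by have [-> _|_] := eqVneq u (g (last s p)); [exact: Cg|rewrite eqxx].
Qed.

Lemma sum_step_forced sigma s p u (b : S -> R) : path (edge M) s p ->
  (forall v, step sigma s p v != 0 -> v = u) ->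
  \sum_(v <- succ_seq (last s p)) step sigma s p v * b v = b u.
Proof.
move=> sp su; rewrite -[RHS]mul1r -(sum_step fbM sigma sp) mulr_suml.
apply: eq_bigr => v _; have [->|/su->//] := eqVneq (step sigma s p v) 0.
by rewrite !mul0r.
Qed.

Lemma restrict_at (x : S -> S -> R) C s0 :
  (forall t u, 0 < x t u) -> (forall t u, x t u <= 1) ->
  (forall f (d : R), 0 < d ->
     (forall n, d <= discount x (f 0%N) (pre f n)) -> Phi f) ->
  preserving C -> serial C -> quarter_optimal C ->
  81 / 100 * value s0 <= safety_value fbM x C s0 ->
  exists C', [/\ forall t u, C' t u -> C t u, serial C', quarter_optimal C' &
    forall tau, conforms C' tau s0 -> 2^-1 * value s0 <= Pr tau s0 Phi].
Proof.
move=> x0 x1 xPhi pC sC qC Vs0.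
have [g gP] := conserving_exists fbM x0 x1 sC.
pose V := safety_value fbM x C; rewrite -/V in gP Vs0.
have V0 t : 0 <= V t by exact: safety_value_ge0.
have V1 t : V t <= 1 by exact: safety_value_le1.
have d0 t p : 0 <= discount x t p by exact/ltW/discount_gt0.
have d1 t p : discount x t p <= 1 by exact: discount_le1.
have gE t : edge M t (g t) by case: (gP t).
pose rho := dirac_strategy gE.
have VS t : ~~ controlled M t ->
    V t <= \sum_(u <- succ_seq t) prob M t u * (x t u * V u).
  by move=> ct; have := safety_value_bellman fbM x0 x1 C t; rewrite /bellman (negPf ct).
have x_ge0 t u : 0 <= x t u by exact: ltW.
(* [g] conserves [V] at controlled states, so the discounted weight times [V] does not decrease on
   average under [rho]. *)
have Vrho t : V t <= Pr rho t Phi.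
  have := @Pr_ge_potential _ _ _ fbM _ mPhi _ x0 x1 xPhi rho t
    (fun p => w rho t p * (discount x t p * V (last t p))).
  rewrite cylinder_weight_nil !mul1r; apply=> p.
    by rewrite ler_wpM2l ?cylinder_weight_ge0// ler_piMr.
  have [->|wp] := eqVneq (w rho t p) 0; [by left; rewrite mul0r|right].
  under eq_bigr do rewrite cylinder_weight_rcons discount_rcons last_rcons -!mulrA.
  rewrite -mulr_sumr ler_wpM2l ?cylinder_weight_ge0//.
  rewrite [leRHS](_ : _ = discount x t p * \sum_(u <- succ_seq (last t p))
    step rho t p u * (x (last t p) u * V u)); last first.
    by rewrite mulr_sumr; apply: eq_bigr => u _; rewrite mulrCA.
  rewrite ler_wpM2l//.
  have [cp|cp] := boolP (controlled M (last t p)).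
    rewrite (dirac_sum fbM gE)//; by have [_ /(_ cp)[]] := gP (last t p).
  by rewrite /step (negPf cp); exact: VS.
have Vv t : V t <= value t by apply: le_trans (Pr_le_value _ _ _).
(* On [Q] the strategy [g] achieves a third of the value; outside it [3 / 2 * V - 2^-1 * value] is
   negative. *)
pose Q t := 3^-1 * value t <= V t.
pose C' t u := C t u /\ (Q t -> u = g t).
have Cg t : controlled M t -> C' t (g t).
  by move=> ct; have [_ /(_ ct)[]] := gP t.
exists C'; split=> [t u []//|t ct|t ot|tau ctau].
- by exists (g t) => //; exact: Cg.
- have crho u : conforms C' rho u by exact: dirac_conforms.
  have := value_ge0 mPhi t; rewrite le_eqVlt => /predU1P[<-|v0].
    by exists rho; rewrite mulr0; split=> //; exact: Pr_ge0.
  have q01 : ((0 : R) < 4^-1) && (4^-1 < (1 : R)) by apply/andP; split; lra.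
  have v4 : 0 < 4^-1 * value t by rewrite mulr_gt0.
  have [sigma [csigma sE]] := near_optimal fbM mPhi tPhi pC q01 qC ot v4.
  pose G p := Q (last t p); exists (switch sigma t G (fun=> rho)); split.
    apply: switch_conforms => [p u up wpu cp|p _ _ _]; last exact: crho.
    split; first exact: csigma.
    by move: up; rewrite unhitE => /andP[_ /negPf Gp] Qp; rewrite /G Qp in Gp.
  have c3 : 0 < 3^-1 :> R by lra.
  (* The potential is a third of the probability that [sigma] has for [Phi]. On entering [Q], [rho]
     secures at least this third; on runs that never enter [Q], [sigma] keeps its whole share. *)
  have := @switch_ge _ _ _ fbM _ mPhi sigma t G (fun=> rho)
    (fun p => 3^-1 * Pr sigma t (Phi `&` starts p)) _ _ mPhi c3.
  have -> : Pr sigma t (Phi `&` starts [::]) = Pr sigma t Phi.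
    by apply: eq_Pr => f; split=> [[]|].
  have := Pr_ge0 sigma t (Phi `&` never G) => PN h.
  suff : 3^-1 * Pr sigma t Phi - 3^-1 * Pr sigma t (Phi `&` never G) +
      Pr sigma t (Phi `&` never G) <= Pr (switch sigma t G (fun=> rho)) t Phi by lra.
  apply: h => p up; first by rewrite (Pr_split fbM)// mulr_sumr.
    move=> Gp; rewrite Pr_switch_hit//.
    apply: (@le_trans _ _ (w sigma t p * (3^-1 * value (last t p)))).
      by rewrite mulrCA ler_pM2l// Pr_starts_le_value.
    by rewrite ler_wpM2l ?cylinder_weight_ge0//; apply: le_trans (Vrho _); exact: Gp.
  exact: lexx.
- pose X p := discount x s0 p * V (last s0 p).
  (* [a] is at most the discounted weight, since [X <= V <= value], and it is
     nonpositive once the run has left [Q]. *)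
  pose a p := w tau s0 p * (3 / 2 * X p - 2^-1 * value (last s0 p)).
  have a0 : 2^-1 * value s0 <= a [::].
    by have := value_ge0 mPhi s0; rewrite /a /X /= cylinder_weight_nil !mul1r; lra.
  apply: le_trans a0 _; apply: (@Pr_ge_potential _ _ _ fbM _ mPhi _ x0 x1 xPhi).
    move=> p; rewrite /a ler_wpM2l ?cylinder_weight_ge0//.
    have h1 : X p <= value (last s0 p).
      by apply: le_trans (Vv _); rewrite ler_piMl.
    have h2 : X p <= discount x s0 p.
      by rewrite ler_piMr.
    by lra.
  move=> p; have [wp|wp] := eqVneq (w tau s0 p) 0; first by left; rewrite /a wp mul0r.
  have sp := cylinder_weight_path wp.
  have [Qp|Qp] := boolP (Q (last s0 p)); [right|left]; last first.
    rewrite /a mulr_ge0_le0 ?cylinder_weight_ge0//.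
    move: Qp; rewrite /Q -ltNge => Qp.
    have h1 : X p <= V (last s0 p) by rewrite ler_piMl.
    by lra.
  (* Within [Q], [tau] must follow [g] at controlled states, so the term in [X] does not decrease on
     average, while the subtracted value does not increase. *)
  rewrite /a; under eq_bigr do rewrite cylinder_weight_rcons -mulrA.
  rewrite -mulr_sumr ler_wpM2l ?cylinder_weight_ge0//.
  under eq_bigr do rewrite mulrBr.
  rewrite sumrB; apply: lerB; last first.
    under eq_bigr do rewrite last_rcons mulrCA.
    rewrite -mulr_sumr ler_pM2l ?invr_gt0//.
    exact: value_superharmonic.
  under eq_bigr do rewrite mulrCA.
  rewrite -mulr_sumr ler_pM2l ?divr_gt0//.
  rewrite [leRHS](_ : _ = discount x s0 p * \sum_(u <- succ_seq (last s0 p))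
    step tau s0 p u * (x (last s0 p) u * V u)); last first.
    rewrite mulr_sumr; apply: eq_bigr => u _.
    by rewrite /X discount_rcons last_rcons mulrCA -mulrA [in LHS](mulrCA (x _ _)).
  rewrite /X ler_wpM2l//.
  have [cp|cp] := boolP (controlled M (last s0 p)); last first.
    by rewrite /step (negPf cp); exact: VS.
  rewrite (@sum_step_forced _ _ _ (g (last s0 p)))//.
    by have [_ /(_ cp)[]] := gP (last s0 p).
  move=> v sv; have [|_] := ctau p v _ cp; last exact.
  by rewrite cylinder_weight_rcons mulf_neq0.
Qed.

Lemma Pr_exhausted sigma s Y (G : nat -> set (nat -> S)) e : mble M Y ->
  (forall n, mble M (G n)) -> (forall n, G n `<=` G n.+1) ->
  (Y `<=` \bigcup_n G n) -> 0 < e ->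
  exists n, Pr sigma s (Y `&` ~` G n) < e.
Proof.
move=> mY mG GS YG e0; apply: contrapT => /forallNP h.
have : e <= Pr sigma s (\bigcap_n (Y `&` ~` G n)).
  apply: Pr_bigcap_ge => [n|n f [Yf Gf]|n].
  - by apply: mble_setI => //; exact: mble_setC.
  - by split=> // /GS.
  - by rewrite leNgt; apply/negP/h.
rewrite leNgt Pr_eq0 ?e0// => f h'.
have [Yf _] := h' 0%N I; have [n _ Gn] := YG f Yf.
by have [_ nG] := h' n I; exact: nG.
Qed.

End Restrict.

(** * Survival weights for the objective *)

Section Objective.
Context (R : realType) (S : countType) (M : mdp R S).
Variable A : nat -> set (S * S).
Implicit Types (s t u : S) (f : nat -> S).
Implicit Types sigma : strategy M.

Definition eventually_in (B : set (S * S)) : set (nat -> S) :=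
  [set f | \forall n \near \oo, B (f n, f n.+1)].

Definition objective : set (nat -> S) := \bigcap_i eventually_in (A i).

Lemma mble_objective : mble M objective.
Proof. by apply: mble_bigcap => i s; exact: measurable_FG. Qed.

Lemma tail_objective : tail objective.
Proof.
move=> f k; split=> fA i _; have [n _ nA] := fA i I.
  exists n => // m /= nm; rewrite addnS; apply: nA => /=.
  exact: leq_trans (leq_addl _ _).
exists (k + n)%N => // m /= nm; have km := leq_trans (leq_addr _ _) nm.
by have := nA (m - k)%N; rewrite /= addnS subnKC//; apply; rewrite leq_subRL.
Qed.

Definition always_from (B : set (S * S)) n : set (nat -> S) :=
  [set f | forall k, (n <= k)%N -> B (f k, f k.+1)].

Lemma mble_always_from B n : mble M (always_from B n).
Proof.
rewrite (_ : always_from B n = \bigcap_k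
    (if (n <= k)%N then [set f | B (f k, f k.+1)] else setT)).
  apply: mble_bigcap => k; case: ifP => _; last exact: mble_setT.
  exact: mble_edge.
apply/seteqP; split=> f h k; first by case: ifP => // nk _; exact: h.
by move=> nk; have := h k I; rewrite nk.
Qed.

(** With [d] the slack above [c], requiring [A i] from a late enough time [N i] on costs at most
    [d / 2 ^+ i.+1]; these losses sum to [d]. *)
Lemma always_from_approx sigma s c : c < Pr sigma s objective ->
  exists N : nat -> nat, c <= Pr sigma s (\bigcap_i always_from (A i) (N i)).
Proof.
move=> cs; pose d := Pr sigma s objective - c.
have d0 : 0 < d by rewrite subr_gt0.
have mO := mble_objective; have mA := mble_always_from.
have [N NP] : {N : nat -> nat & forall i,
    Pr sigma s (objective `&` ~` always_from (A i) (N i)) < d / 2 ^+ i.+1}.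
  apply: (choice (P := fun i n =>
    Pr sigma s (objective `&` ~` always_from (A i) n) < d / 2 ^+ i.+1)) => i.
  apply: (Pr_exhausted (M := M)) => // [n f fn k nk|f /(_ i I)[n _ nA]|].
  - by apply: fn; exact: ltnW.
  - by exists n.
  - by rewrite divr_gt0// exprn_gt0.
exists N.
pose E k := objective `&` \bigcap_(i in [set i | (i < k)%N]) always_from (A i) (N i).
have ES k : E k.+1 = E k `&` always_from (A k) (N k).
  apply/seteqP; split=> f.
    move=> [fO fE]; split; last exact: fE (ltnSn k).
    by split=> // i /= ik; apply: fE => /=; exact: ltnW.
  move=> [[fO fE] fk]; split=> // i /=; rewrite ltnS leq_eqVlt => /predU1P[->//|].
  exact: fE.
have mE k : mble M (E k).
  elim: k => [|k IH]; last by rewrite ES; exact: mble_setI.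
  by rewrite (_ : E 0%N = objective)//; apply/seteqP; split=> f; [case|split].
apply: (@le_trans _ _ (Pr sigma s (\bigcap_k E k))); last first.
  apply: le_Pr => [||f fE i _]; try exact: mble_bigcap.
  by have [_] := fE i.+1 I; apply=> /=.
apply: Pr_bigcap_ge => // [k|k]; first by rewrite ES => f [].
suff : c + d / 2 ^+ k <= Pr sigma s (E k).
  by apply: le_trans; rewrite lerDl divr_ge0 ?exprn_ge0 ?ltW.
elim: k => [|k IH].
  rewrite expr0 divr1 /d addrC subrK (_ : E 0%N = objective)//.
  by apply/seteqP; split=> f; [case|split].
have := Pr_setID sigma s (mE k) (mA (A k) (N k)); rewrite -ES.
have : Pr sigma s (E k `&` ~` always_from (A k) (N k)) <= d / 2 ^+ k.+1.
  apply: le_trans (ltW (NP k)); apply: le_Pr => [||f [[]]//].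
    by apply: mble_setI => //; exact: mble_setC.
  by apply: mble_setI => //; exact: mble_setC.
have : d / 2 ^+ k = d / 2 ^+ k.+1 + d / 2 ^+ k.+1.
  by rewrite exprS invfM; lra.
lra.
Qed.

Section Penalty.
Variables (N : nat -> nat) (e : R).
Hypotheses (e0 : 0 < e) (e1 : e < 1).

(** Partial sums make the times nondecreasing in the index without lowering any of them. *)
Let NN i := (\sum_(j < i.+1) N j)%N.

Let le_NN i j : (i <= j)%N -> (NN i <= NN j)%N.
Proof.
move=> /subnKC <-; elim: (j - i)%N => [|k IH]; first by rewrite addn0.
apply: leq_trans IH _; rewrite addnS /NN [leqRHS]big_ord_recr/=.
exact: leq_addr.
Qed.

Let N_NN i : (N i <= NN i)%N.
Proof. by rewrite /NN big_ord_recr/= leq_addl. Qed.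

Let exit_ex t u : ~ (\bigcap_i A i) (t, u) -> exists i, ~~ `[< A i (t, u) >].
Proof. by move=> /existsNP[i /not_implyP[_ h]]; exists i; apply/asboolPn. Qed.

Definition penalty t u : R :=
  if pselect ((\bigcap_i A i) (t, u)) is right h
  then e / 2 ^+ (NN (ex_minn (exit_ex h))).+1 else 0.

Let penalty_ge0 t u : 0 <= penalty t u.
Proof.
by rewrite /penalty; case: pselect => // h; rewrite divr_ge0 ?exprn_ge0 ?ltW.
Qed.

Let penalty_lt1 t u : penalty t u < 1.
Proof.
rewrite /penalty; case: pselect => // h; rewrite ltr_pdivrMr ?exprn_gt0// mul1r.
by apply: lt_le_trans e1 _; rewrite exprn_ege1// ler1n.
Qed.

Definition survival t u : R := 1 - penalty t u.

Lemma survival_gt0 t u : 0 < survival t u.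
Proof. by rewrite subr_gt0. Qed.

Lemma survival_le1 t u : survival t u <= 1.
Proof. by rewrite lerBlDr lerDl. Qed.

(** An edge outside [A i] has its first missed index at most [i], hence penalty at least [h].
    Infinitely many such edges, each lowering the discount by at least [d * h], would make it
    negative. *)
Lemma discount_objective f (d : R) : 0 < d ->
  (forall n, d <= discount survival (f 0%N) (pre f n)) -> objective f.
Proof.
move=> d0 fd i _; apply: contrapT => nA.
pose h : R := e / 2 ^+ (NN i).+1.
have h0 : 0 < h by rewrite divr_gt0 ?exprn_gt0.
have bad n : exists2 k, (n <= k)%N & ~ A i (f k, f k.+1).
  apply: contrapT => nk; apply: nA; exists n => // k /= nk'.
  by apply: contrapT => nAk; apply: nk; exists k.
pose D n := discount survival (f 0%N) (pre f n).
have DS n : D n.+1 = D n * survival (f n) (f n.+1).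
  by rewrite /D preS discount_rcons last_pre.
have D0 n : 0 < D n by exact: discount_gt0 survival_gt0 _ _.
have Dle n k : (n <= k)%N -> D k <= D n.
  move=> /subnKC <-; elim: (k - n)%N => [|m IH]; first by rewrite addn0.
  by rewrite addnS DS; apply: le_trans IH; rewrite ler_piMr ?survival_le1// ltW.
have drop m : exists n, D n <= 1 - m%:R * (d * h).
  elim: m => [|m [n nm]]; first by exists 0%N; rewrite mul0r subr0.
  have [k nk Ak] := bad n; exists k.+1; rewrite DS /survival mulrBr mulr1.
  suff : d * h <= D k * penalty (f k) (f k.+1).
    by have := Dle _ _ nk; rewrite -natr1; lra.
  apply: ler_pM; [exact: ltW|exact: ltW|exact: fd|].
  rewrite /penalty; case: pselect => [/(_ i I)//|E].
  rewrite ler_pM2l// lef_pV2 ?posrE ?exprn_gt0// ler_eXn2l ?ltr1n// ltnS.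
  by apply: le_NN; case: ex_minnP => j _; apply; apply/asboolPn.
have dh0 : 0 < d * h by rewrite mulr_gt0.
have [n] := drop (Num.bound (d * h)^-1).
have : 1 < (Num.bound (d * h)^-1)%:R * (d * h).
  by rewrite -ltr_pdivrMr// mul1r archi_boundP// invr_ge0 ltW.
by have := D0 n; lra.
Qed.

(** The edge taken at time [n] can miss [A j] only when [n < N j], so its penalty is at most
    [e / 2 ^+ n.+1]. The induction carries the unspent part [e / 2 ^+ n] of the budget. *)
Lemma discount_always_from s (f : run M s) n :
  (\bigcap_i always_from (A i) (N i)) f -> 1 - e <= discount survival s (pre f n).
Proof.
move=> fA; suff : 1 - e + e / 2 ^+ n <= discount survival s (pre f n).
  by apply: le_trans; rewrite lerDl divr_ge0 ?exprn_ge0 ?ltW.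
elim: n => [|n IH]; first by rewrite expr0 divr1 subrK.
rewrite preS discount_rcons last_pre ?state0// /survival mulrBr mulr1.
have le2 : penalty (f n) (f n.+1) <= e / 2 ^+ n.+1.
  rewrite /penalty; case: pselect => [_|E]; first by rewrite divr_ge0 ?exprn_ge0 ?ltW.
  rewrite ler_pM2l// lef_pV2 ?posrE ?exprn_gt0// ler_eXn2l ?ltr1n// ltnS.
  case: ex_minnP => j /asboolPn Aj _; rewrite ltnW//; apply: leq_trans (N_NN j).
  by rewrite ltnNge; apply/negP => /(fA j I).
have : discount survival s (pre f n) * penalty (f n) (f n.+1)
    <= penalty (f n) (f n.+1).
  rewrite ler_piMl// discount_le1//; first exact: survival_gt0.
  exact: survival_le1.
have : e / 2 ^+ n = e / 2 ^+ n.+1 + e / 2 ^+ n.+1 by rewrite exprS invfM; lra.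
lra.
Qed.

End Penalty.

End Objective.

(** * Plastering *)

Section Assembly.
Context (R : realType) (S : countType) (M : mdp R S).
Hypothesis fbM : finitely_branching M.
Variable A : nat -> set (S * S).
Implicit Types (s t u : S) (p q r : seq S).
Implicit Types sigma tau kappa : strategy M.
Implicit Types C : S -> S -> Prop.

Local Notation w := cylinder_weight.
Local Notation succ_seq := (succ_seq fbM).
Local Notation Phi := (objective A).
Local Notation value := (value M Phi).
Local Notation has_optimal := (has_optimal M Phi).
Local Notation preserving := (preserving M Phi).
Local Notation quarter_optimal := (quarter_optimal M Phi).
Local Notation serial := (serial M).
Local Notation mPhi := (@mble_objective R S M A).
Local Notation tPhi := (@tail_objective S A).

Definition good C := [/\ preserving C, serial C & quarter_optimal C].

Lemma good_restrict C s : good C -> exists C',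
  [/\ good C', forall t u, C' t u -> C t u & has_optimal s ->
    forall tau, conforms C' tau s -> 2^-1 * value s <= Pr tau s Phi].
Proof.
move=> gC; have [pC sC qC] := gC.
have [os|os] := pselect (has_optimal s); last by exists C; split.
have := value_ge0 mPhi s; rewrite le_eqVlt => /predU1P[v0|v0].
  by exists C; split=> // _ tau _; rewrite -v0 mulr0; exact: Pr_ge0.
have q01 : ((0 : R) < 4^-1) && (4^-1 < (1 : R)) by apply/andP; split; lra.
have v10 : 0 < 10^-1 * value s by rewrite mulr_gt0.
have [sigma [csigma]] := near_optimal fbM mPhi tPhi pC q01 qC os v10.
move=> /always_from_approx[N NE].
have e0 : 0 < 10^-1 :> R by lra.
have e1 : 10^-1 < 1 :> R by lra.
have x0 := survival_gt0 A N e1; have x1 := survival_le1 A N e0.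
have := safety_value_ge_Pr fbM x0 (c := 1 - 10^-1)
  (Y := \bigcap_i always_from (A i) (N i)) _ _ csigma _.
have mE : mble M (\bigcap_i always_from (A i) (N i)).
  by apply: mble_bigcap => i; exact: mble_always_from.
have c0 : 0 <= 1 - 10^-1 :> R by lra.
move=> /(_ mE c0)-/(_ (fun f fE n => discount_always_from e0 e1 n fE)) Vs.
have [|C' [C'C sC' qC' hC']] := @restrict_at _ _ _ fbM _ mPhi tPhi _ _ s x0 x1
  (discount_objective e0 e1) pC sC qC.
  apply: le_trans Vs.
  (* The bound [81 / 100] is nine tenths for survival times nine tenths for near optimality. *)
  apply: (@le_trans _ _ ((1 - 10^-1) * (value s - 10^-1 * value s))).
    by lra.
  by rewrite ler_wpM2l.
exists C'; split=> //; split=> // t u ct ot /C'C.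
exact: pC.
Qed.

Lemma good_optimal_edge : good (optimal_edge M Phi).
Proof.
split.
- by move=> t u _ ot /(_ ot).
- move=> t ct; have [[sigma os]|nt] := pselect (has_optimal t); last first.
    by exists (default_succ M t); [exact: default_edge|move=> /nt].
  have [u tu st] : exists2 u, edge M t u & step sigma t [::] u != 0.
    apply: contrapT => nu; have := @sum_step _ _ _ fbM sigma t [::] isT.
    rewrite big_seq big1 => [/eqP|u]; first by rewrite eq_sym oner_eq0.
    rewrite mem_succ_seq => tu; apply/eqP; apply: contrapT => st; apply: nu.
    by exists u => //; exact/negP.
  exists u => //; apply: (optimal_conforms fbM mPhi tPhi os (p := [::])) => //=.
  by rewrite weight_seq1.
- move=> t [sigma os]; exists sigma; split.
    exact: (optimal_conforms fbM mPhi tPhi os).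
  by rewrite os; have := value_ge0 mPhi t; lra.
Qed.

(** The relation is the intersection of a decreasing chain that treats the state with code [k] at
    stage [k]. A strategy conforming to the intersection conforms to every stage, hence inherits
    each bound. *)
Lemma uniform_restriction : exists C, [/\ preserving C, serial C &
  forall s, has_optimal s -> forall tau, conforms C tau s ->
    2^-1 * value s <= Pr tau s Phi].
Proof.
pose P (Cs : (S -> S -> Prop) * S) C' := good Cs.1 ->
  [/\ good C', forall t u, C' t u -> Cs.1 t u & has_optimal Cs.2 ->
    forall tau, conforms C' tau Cs.2 -> 2^-1 * value Cs.2 <= Pr tau Cs.2 Phi].
have [next nextP] : {next & forall Cs, P Cs (next Cs)}.
  apply: choice => -[C s]; rewrite /P /=.
  by have [/(good_restrict s)[C' ?]|nC] := pselect (good C); [exists C'|exists C].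
pose fix Cn n : S -> S -> Prop := if n is k.+1 then
  (if unpickle k is Some s then next (Cn k, s) else Cn k) else optimal_edge M Phi.
have goodC n : good (Cn n).
  elim: n => [|n IH]; first exact: good_optimal_edge.
  by rewrite /=; case: (unpickle n) => [s|//]; have [] := nextP (Cn n, s) IH.
have CS n t u : Cn n.+1 t u -> Cn n t u.
  rewrite /=; case: (unpickle n) => [s|//].
  by have [_ h _] := nextP (Cn n, s) (goodC n); exact: h.
have Cle m n t u : (m <= n)%N -> Cn n t u -> Cn m t u.
  move=> /subnKC <-; elim: (n - m)%N => [|k IH]; first by rewrite addn0.
  by rewrite addnS => /CS.
exists (fun t u => forall n, Cn n t u); split.
- by move=> t u ct ot /(_ 0%N); have [pC _ _] := goodC 0%N; exact: pC.
(* If each of the finitely many successors were excluded at some stage, the latest of these stages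
   would exclude all of them, against its seriality. *)
- move=> t ct; apply: contrapT => nt.
  have [n nP] : exists n, {in succ_seq t, forall u, ~ Cn n t u}.
    have : {in succ_seq t, forall u, exists n, ~ Cn n t u}.
      move=> u; rewrite mem_succ_seq => tu; apply/existsNP => Ctu.
      by apply: nt; exists u.
    elim: (succ_seq t) => [|v l IH] vl; first by exists 0%N.
    have [m mv] := vl v (mem_head _ _).
    have [u ul|n nl] := IH; first by apply: vl; rewrite inE ul orbT.
    exists (maxn m n) => u; rewrite inE => /predU1P[->|/nl nu].
      by move=> /(Cle m); rewrite leq_maxl => /(_ isT).
    by move=> /(Cle n); rewrite leq_maxr => /(_ isT).
  have [_ /(_ t ct)[u tu Cu] _] := goodC n.
  by apply: (nP u) => //; rewrite mem_succ_seq.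
- move=> s os tau ctau; have [_ _] := nextP (Cn (pickle s), s) (goodC _).
  apply=> // p u wpu cp; have := ctau p u wpu cp (pickle s).+1.
  by rewrite /= pickleK.
Qed.

(** Both strategies give every cylinder the same weight; [Pr_tail] at the empty prefix turns this
    into equal probabilities of the objective. *)
Lemma forced_Pr sigma g (gE : forall s, edge M s (g s)) s :
  conforms (fun t u => u = g t) sigma s ->
  Pr sigma s Phi = Pr (dirac_strategy gE) s Phi.
Proof.
move=> csigma; have wE q : w sigma s q = w (dirac_strategy gE) s q.
  elim/last_ind: q => [|q u IH]; first by rewrite !cylinder_weight_nil.
  rewrite !cylinder_weight_rcons -IH.
  have [->|wq] := eqVneq (w sigma s q) 0; first by rewrite !mul0r.
  congr (_ * _); have sq := cylinder_weight_path wq.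
  have [cq|cq] := boolP (controlled M (last s q)); last first.
    by rewrite /step (negPf cq).
  have su v : step sigma s q v != 0 -> v = g (last s q).
    move=> sv; apply: csigma => //.
    by rewrite cylinder_weight_rcons mulf_neq0.
  rewrite [RHS]/step cq /= /dirac_move.
  have [->|ug] := eqVneq u (g (last s q)); last first.
    by apply/eqP; apply: contraNT ug => /su->.
  have := sum_step_forced fbM (fun=> 1) sq su; rewrite -[X in _ = X -> _]/1.
  rewrite (bigD1_seq (g (last s q))) ?succ_seq_uniq ?mem_succ_seq//= mulr1.
  rewrite big1 ?addr0// => v vg; apply/eqP; rewrite mulr1.
  by apply: contraNT vg => /su->.
have T X tau : Pr tau s (X `&` starts [::]) = Pr tau s X.
  by apply: eq_Pr => f; split=> [[]|].
rewrite -T (Pr_tail (kappa := dirac_strategy gE) (p := [::]) _ mPhi tPhi).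
  by rewrite cylinder_weight_nil mul1r.
by move=> q; rewrite cylinder_weight_nil mul1r.
Qed.

Lemma dirac_memoryless g (gE : forall s, edge M s (g s)) :
  memoryless (dirac_strategy gE).
Proof. by move=> s p s' p' _ _ lE u; rewrite /= /dirac_move lE. Qed.

Lemma dirac_deterministic g (gE : forall s, edge M s (g s)) :
  deterministic (dirac_strategy gE).
Proof. by move=> s p _; exists (g (last s p)). Qed.

Lemma optimal_dirac : exists g (gE : forall s, edge M s (g s)),
  forall s, has_optimal s -> Pr (dirac_strategy gE) s Phi = value s.
Proof.
have [C [pC sC hC]] := uniform_restriction.
have [g gP] : {g & forall t, edge M t (g t) /\ (controlled M t -> C t (g t))}.
  apply: (choice (P := fun t u => edge M t u /\ (controlled M t -> C t u))) => t.
  have [/sC[u tu Cu]|ct] := boolP (controlled M t); first by exists u.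
  by exists (default_succ M t); split=> //; exact: default_edge.
have gE t : edge M t (g t) by case: (gP t).
exists g, gE => s os; apply/eqP; rewrite eq_le Pr_le_value//=; last exact: mPhi.
have pg : preserving (fun t u => u = g t).
  by move=> t u ct ot ->; apply: pC => //; case: (gP t) => _; exact.
have h01 : ((0 : R) < 2^-1) && (2^-1 < (1 : R)) by apply/andP; split; lra.
(* All strategies that conform to the graph of [g] have the same probability of the objective, so
   approaching the value among them means attaining it. *)
apply/ler_addgt0Pr => e e0; rewrite -lerBlDr.
have [|sigma [/(forced_Pr gE)<- /ltW//]] := near_optimal fbM mPhi tPhi pg h01 _ os e0.
move=> t ot; exists (dirac_strategy gE); split; first exact: dirac_conforms.
by apply: hC => //; apply: dirac_conforms => u; case: (gP u).
Qed.

End Assembly.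

Theorem corollary32 (R : realType) (S : countType) (M : mdp R S)
    (M_fin : finitely_branching M)
    (A : nat -> set (S * S))
    (A_trans : forall i, A i `<=` transitions M)
    (A_decr : forall i, A i.+1 `<=` A i) :
  exists sigma : strategy M,
    [/\ memoryless sigma, deterministic sigma &
     forall s : S,
       (exists tau : strategy M, optimal tau (\bigcap_i FG M s (A i))) ->
       optimal sigma (\bigcap_i FG M s (A i))].
Proof.
have mPhi := @mble_objective R S M A.
have [g [gE gP]] := optimal_dirac M_fin A.
exists (dirac_strategy gE); split.
- exact: dirac_memoryless.
- exact: dirac_deterministic.
- move=> s [tau /(optimalE mPhi) ot]; apply/(optimalE mPhi)/gP.
  by exists tau.
Qed.
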